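(* Let $n\ge2$ and let $\varepsilon$ be a surjective $n$-periodic sign function. Let $\beta$ be the edge vector of an edge $\ell=(p_i,p_j)$, $i<j$, of an $n$-periodic tree $\mathcal{T}$ with sign function $\varepsilon$, so $\beta=\pm\beta_{ij}$, and write $D(\beta)=D(\beta_{ij})$ for the real support. Let $\partial_\ell(\mathcal{T})\subseteq\mathbb{R}^n$ be the set of all $v=(E_\varepsilon^t)^{-1}F(\pi)$, where $\pi$ ranges over the points of the closure of $\mathcal{R}(\mathcal{T})$ with $\pi(i)=\pi(j)$ (the points corresponding to the limit points of the embeddings of $\mathcal{T}$ in which the edge $\ell$ becomes horizontal). Then $\partial_\ell(\mathcal{T})$ is a subset of $D(\beta)$, and $D(\beta)$ is the closure of the union of the sets $\partial_{\ell'}(\mathcal{T}')$ over all $n$-periodic trees $\mathcal{T}'$ with sign function $\varepsilon$ having an edge $\ell'$ with edge vector $\pm\beta$.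
   Context: PERIODIC TREES. $\varepsilon:\mathbb{Z}\to\{+,-\}$ is $n$-periodic if $\varepsilon_{i+n}=\varepsilon_i$. An $n$-periodic poset is a set $P=\{p_i : i\in\mathbb{Z}\}$ (distinct $p_i$) with a partial order such that $p_i<p_j\Leftrightarrow p_{i+n}<p_{j+n}$. $p$ is a child of $q$ (and $q$ a parent of $p$) if $p<q$ and no $x$ satisfies $p<x<q$. The Hasse diagram is the directed graph with vertex set $P$ and an edge from each child to each of its parents; it is required that whenever $p<q$ there is a directed path from $p$ to $q$. An edge with endpoints $p_i,p_j$, $i<j$, is written $\ell=(p_i,p_j)$. It has positive slope if $p_i<p_j$ ($p_j$ is then a right parent of $p_i$, and $p_i$ a left child of $p_j$) and negative slope if $p_i>p_j$ ($p_j$ is a right child of $p_i$, and $p_i$ a left parent of $p_j$). An $n$-periodic tree with sign function $\varepsilon$ is the Hasse diagram $\mathcal{T}$ of an $n$-periodic poset such that the underlying graph is a tree (connected, no cycles) and: (T1) each $p_i$ has at most one left parent, at most one right parent, at most one left child, at most one right child; (T2) if $\varepsilon_i=+$ then $p_i$ has at most one parent; (T3) if $\varepsilon_i=-$ then $p_i$ has at most one child; (T4) for every edge $(p_i,p_j)$ and every $i<k<j$: (a) if $p_k<p_i$ and $p_k<p_j$ then $\varepsilon_k=+$; (b) if $p_k>p_i$ and $p_k>p_j$ then $\varepsilon_k=-$. REGION. An $n$-periodic function is $\pi:\mathbb{Z}\to\mathbb{R}$ with $\pi(i+n)-\pi(i)$ independent of $i$; these form a vector space isomorphic to $\mathbb{R}^{n+1}$.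 $\mathcal{R}(\mathcal{T})$ is the (open, convex) set of $n$-periodic $\pi$ with $\pi(i)<\pi(j)$ whenever $p_i<p_j$ in $\mathcal{T}$; each such $\pi$ gives an embedding of $\mathcal{T}$ in the plane, linear on edges, with $p_k\mapsto(k,\pi(k))$. $F(\pi)=y\in\mathbb{R}^n$, $y_i=\pi(i)-\pi(i-1)$, $1\le i\le n$. EDGE VECTORS. For $k\in\mathbb{Z}$ let $\overline k\in\{1,\dots,n\}$, $\overline k\equiv k$ mod $n$; for $i<j$, $\beta_{ij}=e_{\overline{i+1}}+\cdots+e_{\overline j}\in\mathbb{Z}^n$. The edge vector of $\ell=(p_i,p_j)$ is $\pm\beta_{ij}$, with the sign of the slope of $\ell$. QUIVER AND ROOTS. $\widetilde A_{n-1}^\varepsilon$ has vertices $1,\dots,n$ and, for each $i$, one arrow between $i$ and $\overline{i+1}$: $\overline{i+1}\to i$ if $\varepsilon_i=+$ and $i\to\overline{i+1}$ if $\varepsilon_i=-$. The Euler matrix $E_\varepsilon$ has $1$'s on the diagonal and $(i,j)$ entry minus the number of arrows $i\to j$ for $i\neq j$ (it is invertible); $\langle x,y\rangle=x^tE_\varepsilon y$. The real Schur roots are the $\beta_{ij}$, $i<j$, with either $\varepsilon_i\ne\varepsilon_j$, or $\varepsilon_i=\varepsilon_j$ and $j<i+n$; every edge vector is a real Schur root up to sign. For $a<b$ let $M_{ab}$ be the string module of dimension vector $\beta_{ab}$ (over a field $\mathbf{k}$) with basis $x_{a+1},\dots,x_b$, $x_k$ placed at vertex $\overline k$, where for $a<k<b$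 the arrow between $\overline k$ and $\overline{k+1}$ indexed by $\overline k$ sends $x_{k+1}\mapsto x_k$ if $\varepsilon_k=+$ and $x_k\mapsto x_{k+1}$ if $\varepsilon_k=-$, all other actions of arrows on basis elements being zero. $\beta_{ab}$ is a subroot of $\beta_{ij}$, $\beta_{ab}\subseteq\beta_{ij}$, if $M_{ab}$ is isomorphic to a submodule of $M_{ij}$. REAL SUPPORT. For a real Schur root $\beta_{ij}$, $D(\beta_{ij})$ is the set of all $v\in\mathbb{R}^n$ with $\langle v,\beta_{ij}\rangle=0$ and $\langle v,\beta_{ab}\rangle\le0$ for all real Schur subroots $\beta_{ab}\subseteq\beta_{ij}$. *)

(* Defs.v *)
From mathcomp Require Export all_boot all_order all_algebra.
From mathcomp Require Export all_classical all_reals all_analysis.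
Export Order.TTheory GRing.Theory Num.Theory.
Export numFieldNormedType.Exports.

Set Implicit Arguments.
Unset Strict Implicit.
Unset Printing Implicit Defensive.

Local Open Scope classical_set_scope.
Local Open Scope ring_scope.

(* A sign function is [eps : int -> bool], with [true] for + and [false] for -. *)
Definition periodic_sign (n : nat) (eps : int -> bool) : Prop :=
  forall i : int, eps (i + n%:Z) = eps i.

Definition surjective_sign (eps : int -> bool) : Prop :=
  forall s : bool, exists i : int, eps i = s.

Section Hasse.
Variable lt : rel int.

Definition child : rel int :=
  fun p q => `[< lt p q /\ ~ exists x : int, lt p x /\ lt x q >].

Definition adjacent : rel int := fun p q => child p q || child q p.

Definition parents (p : int) : set int := [set q | child p q].
Definition children (p : int) : set int := [set q | child q p].
Definition left_parents (p : int) : set int := [set q | child p q /\ q < p].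
Definition right_parents (p : int) : set int := [set q | child p q /\ p < q].
Definition left_children (p : int) : set int := [set q | child q p /\ q < p].
Definition right_children (p : int) : set int := [set q | child q p /\ p < q].

Definition is_edge (i j : int) : Prop := i < j /\ adjacent i j.

Definition connected_graph : Prop :=
  forall p q : int, exists s : seq int, path adjacent p s /\ last p s = q.

(* The graph is simple, so a cycle has at least three distinct vertices. *)
Definition acyclic_graph : Prop :=
  forall c : seq int, uniq c -> cycle adjacent c -> (size c <= 2)%N.

End Hasse.

(* The strict order of an n-periodic poset; the element p_i is encoded by its
   index i. *)
Record periodic_poset (n : nat) := PeriodicPoset {
  plt :> rel int;
  plt_irr : irreflexive plt;
  plt_trans : transitive plt;
  plt_periodic : forall i j : int, plt i j = plt (i + n%:Z) (j + n%:Z);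
  plt_path : forall p q : int, plt p q ->
    exists s : seq int, path (child plt) p s /\ last p s = q
}.

(* A tree is recorded by its poset, which its Hasse diagram determines by
   [plt_path]. *)
Record periodic_tree (n : nat) (eps : int -> bool) := PeriodicTree {
  tree_poset :> periodic_poset n;
  tree_connected : connected_graph tree_poset;
  tree_acyclic : acyclic_graph tree_poset;
  tree_T1 : forall i : int,
    [/\ is_subset1 (left_parents tree_poset i),
        is_subset1 (right_parents tree_poset i),
        is_subset1 (left_children tree_poset i) &
        is_subset1 (right_children tree_poset i)];
  tree_T2 : forall i : int, eps i = true -> is_subset1 (parents tree_poset i);
  tree_T3 : forall i : int, eps i = false -> is_subset1 (children tree_poset i);
  tree_T4 : forall i j k : int, is_edge tree_poset i j -> i < k -> k < j ->
    (tree_poset k i -> tree_poset k j -> eps k = true) /\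
    (tree_poset i k -> tree_poset j k -> eps k = false)
}.

(* The vertices 1, ..., n of the quiver, and the indices of its n arrows, are
   encoded by 'I_n, with [v : 'I_n] standing for v + 1.  [at_vertex k v] says
   that the residue of k in {1, ..., n} is the vertex encoded by v. *)
Definition at_vertex (n : nat) (k : int) (v : 'I_n) : bool :=
  (k == v.+1%:Z %[mod n%:Z])%Z.

Definition unit_vec (n : nat) (k : int) : 'cV[int]_n :=
  \col_(v < n) (at_vertex k v)%:R.

(* Meant for i < j. *)
Definition beta (n : nat) (i j : int) : 'cV[int]_n :=
  \sum_(m < `|j - i|%N) unit_vec n (i + 1 + m%:Z).

Definition edge_vector (n : nat) (T : periodic_poset n) (i j : int)
    : 'cV[int]_n :=
  if T i j then beta n i j else - beta n i j.

Section Quiver.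
Variables (n : nat) (eps : int -> bool).

(* Integer representatives of the end points of the arrow encoded by q, which
   lies between the vertices q + 1 and q + 2 (mod n). *)
Definition arrow_source (q : 'I_n) : int :=
  if eps q.+1%:Z then q.+2%:Z else q.+1%:Z.
Definition arrow_target (q : 'I_n) : int :=
  if eps q.+1%:Z then q.+1%:Z else q.+2%:Z.

Definition num_arrows (v w : 'I_n) : nat :=
  #|[set q : 'I_n | at_vertex (arrow_source q) v
                    & at_vertex (arrow_target q) w]|.

Definition euler_matrix (R : pzRingType) : 'M[R]_n :=
  \matrix_(v, w) (if v == w then 1 else - (num_arrows v w)%:R).

Definition euler_form (R : pzRingType) (x y : 'cV[R]_n) : R :=
  (x^T *m euler_matrix R *m y) 0 0.

(* [real_schur_pair i j] : beta_ij is a real Schur root. *)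
Definition real_schur_pair (i j : int) : Prop :=
  i < j /\ (eps i != eps j \/ (eps i = eps j /\ j < i + n%:Z)).

End Quiver.

(* A module over the path algebra with a chosen basis, given by the actions of
   the trivial paths and of the arrows.  Elements are row vectors of
   coordinates, acted on by multiplication on the right: row r of an acting
   matrix is the image of the r-th basis element. *)
Record path_action (n : nat) (k : fieldType) := PathAction {
  act_dim : nat;
  act_vertex : 'I_n -> 'M[k]_act_dim;
  act_arrow : 'I_n -> 'M[k]_act_dim
}.

Definition is_submodule (n : nat) (k : fieldType) (M : path_action n k)
    (U : 'M[k]_(act_dim M)) : Prop :=
  forall q : 'I_n, stablemx U (act_vertex M q) /\ stablemx U (act_arrow M q).

Definition is_module_hom (n : nat) (k : fieldType) (M N : path_action n k)
    (f : 'M[k]_(act_dim M, act_dim N)) : Prop :=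
  forall q : 'I_n, act_vertex M q *m f = f *m act_vertex N q /\
                   act_arrow M q *m f = f *m act_arrow N q.

Definition iso_to_submodule (n : nat) (k : fieldType) (M N : path_action n k)
    : Prop :=
  exists U : 'M[k]_(act_dim N), is_submodule U /\
  exists f : 'M[k]_(act_dim M, act_dim N),
    [/\ is_module_hom f, row_free f & (f :=: U)%MS].

(* M_ab for a < b; the basis element x_k is the one of index r = k - a - 1. *)
Definition string_module (n : nat) (eps : int -> bool) (k : fieldType)
    (a b : int) : path_action n k :=
  @PathAction n k `|b - a|%N
    (fun v => \matrix_(r, s)
       ((r == s) && at_vertex (a + 1 + (r : nat)%:Z) v)%:R)
    (fun q => \matrix_(r, s)
       ([&& (r == s.+1 :> nat), eps (a + 1 + (s : nat)%:Z)
          & at_vertex (a + 1 + (s : nat)%:Z) q]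
     || [&& (s == r.+1 :> nat), ~~ eps (a + 1 + (r : nat)%:Z)
          & at_vertex (a + 1 + (r : nat)%:Z) q])%:R).

(* beta_ab is a subroot of beta_ij, for a < b and i < j. *)
Definition subroot (n : nat) (eps : int -> bool) (k : fieldType)
    (a b i j : int) : Prop :=
  iso_to_submodule (string_module n eps k a b) (string_module n eps k i j).

Section Geometry.
Variables (R : realType) (n : nat) (eps : int -> bool).

Definition beta_real (i j : int) : 'cV[R]_n := map_mx intr (beta n i j).

Definition real_support (k : fieldType) (i j : int) : set 'cV[R]_n :=
  [set v | euler_form eps v (beta_real i j) = 0 /\
     forall a b : int, real_schur_pair n eps a b -> subroot n eps k a b i j ->
       euler_form eps v (beta_real a b) <= 0].

Definition periodic_function (pi : int -> R) : Prop :=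
  forall i j : int, pi (i + n%:Z) - pi i = pi (j + n%:Z) - pi j.

(* The topology of pointwise convergence induces the usual topology on the
   finite-dimensional, closed subspace of n-periodic functions. *)
Definition region (T : periodic_poset n) : set {ptws int -> R} :=
  [set pi | periodic_function pi /\ forall i j : int, T i j -> pi i < pi j].

Definition increments (pi : int -> R) : 'cV[R]_n :=
  \col_(v < n) (pi v.+1%:Z - pi (v : nat)%:Z).

Definition edge_boundary (T : periodic_poset n) (i j : int) : set 'cV[R]_n :=
  [set v | exists pi : {ptws int -> R},
     [/\ closure (region T) pi, pi i = pi j &
         v = invmx (euler_matrix n eps R)^T *m increments pi]].

End Geometry.

Arguments real_support R n eps k i j : clear implicits.
Arguments edge_boundary R {n} eps T i j.

(* Main.v *)
Require Import Defs.
From mathcomp Require Import zify ring lra.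
From Stdlib Require Import Relation_Operators.

Set Implicit Arguments.
Unset Strict Implicit.
Unset Printing Implicit Defensive.

Local Open Scope classical_set_scope.
Local Open Scope ring_scope.

(** Multiplication by the transpose of the Euler matrix turns a vector v into
the increments of an n-periodic function pi, unique up to a constant, and
<v, beta_ab> becomes pi(b) - pi(a).  Everything is read off from pi.  The
real support of beta_ij consists of the pi with pi(i) = pi(j) such that,
strictly between i and j, the points of sign - lie on or above the horizontal
edge and those of sign + on or below it ([sign_split]).

That description has two halves.  If M_ab embeds in M_ij with image U, the
basis vectors at the positions of the leading terms of homogeneous elements of
U span a submodule with the dimension vector of U, because every arrow shifts
the basis of M_ij by a constant; so pi(b) - pi(a) is a sum of increments of pi
over a set of positions closed under the arrows, and summation by parts makes
it nonpositive ([subroot_le]).  Conversely the subintervals of (i, j] closed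
under the arrows give subroots, enough of which are real Schur to force the
position of every point ([support_sign_split]).

For an edge of a tree, a point of sign - between its ends is above one of them
in the poset, and dually ([edge_side]): a vertex that branches upwards
separates its left branch from its right branch, so that a walk from the point
to the edge has to start downwards and can never turn up again.  Hence limits
of embeddings of the tree satisfy [sign_split], which is the first inclusion;
the same facts show that an edge is a real Schur pair and that it is determined
by its edge vector up to translation.

For the closure, a function satisfying [sign_split] is approximated by a
multiple of an integer-valued one satisfying it strictly and having no
coincidences of values besides those between translates of i and j
([integer_approximation]).  Lifting the translates of j slightly gives an
injective height function.  Any injective periodic height function is
compatible with a periodic tree: q lies above p if q can be reached from p by
climbing from vertex to vertex, where each one must see the next past the walls
that hang down from the points of sign + and rise from those of sign -
([height_tree]).  Here i and j have consecutive heights and see each other, so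
they form an edge. *)

(** * Walks in a periodic tree *)

Definition between (k a b : int) : bool := (a < k < b) || (b < k < a).

Section Sides.
Variables (n : nat) (eps : int -> bool) (T : periodic_tree n eps).

(** A direction is named by the sign of the vertices that may branch in it:
those of sign + (d = true) may have two children, those of sign - two parents.
Each statement below thus covers the poset and its opposite at once. *)
Definition step (d : bool) : rel int :=
  fun p q => if d then child T q p else child T p q.

Definition ord (d : bool) : rel int :=
  fun p q => if d then T q p else T p q.

Lemma stepW d p q : step d p q -> ord d p q.
Proof. by case: d => /asboolP[]. Qed.

Lemma step_rev d p q : step (~~ d) p q = step d q p.
Proof. by case: d. Qed.

Lemma ord_rev d p q : ord (~~ d) p q = ord d q p.
Proof. by case: d. Qed.

Lemma ord_irr d p : ord d p p = false.
Proof. by rewrite /ord !plt_irr; case: d. Qed.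

Lemma ord_trans d : transitive (ord d).
Proof.
move=> y x z; case: d => /=; last exact: plt_trans.
by move=> yx zy; exact: plt_trans zy yx.
Qed.

Lemma adjacent_step d p q : adjacent T p q = step d p q || step (~~ d) p q.
Proof. by case: d => //=; rewrite orbC. Qed.

Lemma adjacent_sym p q : adjacent T p q = adjacent T q p.
Proof. exact: orbC. Qed.

Lemma adjacent_neq p q : adjacent T p q -> p != q.
Proof.
rewrite (adjacent_step true) => /orP[] /stepW; apply: contraTneq => ->;
by rewrite ord_irr.
Qed.

(** By (T1) two children, or two parents, are on different sides; (T2) and (T3)
say which sign allows two of them. *)
Lemma branching d m a b : step d m a -> step d m b -> a != b ->
  eps m = d /\ between m a b.
Proof.
move=> ma mb ab.
have am : a != m.
  by have := stepW ma; apply: contraTneq => ->; rewrite ord_irr.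
have bm : b != m.
  by have := stepW mb; apply: contraTneq => ->; rewrite ord_irr.
have [lp rp lc rc] := tree_T1 T m.
case: d ma mb => /= ma mb; split.
- by case E: (eps m) => //; have /eqP := tree_T3 E ma mb; rewrite (negbTE ab).
- rewrite /between; case: (ltgtP a m) am => // a_m _;
    case: (ltgtP b m) bm => // b_m _; exfalso; move/eqP: ab; apply;
  by [exact: lc | exact: rc].
- by case E: (eps m) => //; have /eqP := tree_T2 E ma mb; rewrite (negbTE ab).
- rewrite /between; case: (ltgtP a m) am => // a_m _;
    case: (ltgtP b m) bm => // b_m _; exfalso; move/eqP: ab; apply;
  by [exact: lp | exact: rp].
Qed.

(** Part (a) of (T4) for d = false, part (b) for d = true. *)
Lemma blocking d k a b : adjacent T a b -> between k a b ->
  ord d k a -> ord d k b -> eps k = ~~ d.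
Proof.
move=> ab /orP[/andP[ak kb]|/andP[bk ka]] oa ob.
- have e : is_edge T a b by split=> //; exact: lt_trans ak kb.
  have [A B] := tree_T4 e ak kb; case: d oa ob => /=; [exact: B | exact: A].
- have e : is_edge T b a.
    by split; [exact: lt_trans bk ka | rewrite adjacent_sym].
  have [A B] := tree_T4 e bk ka; case: d oa ob => /= oa ob;
  by [rewrite B | rewrite A].
Qed.

Lemma path_step_ord d x s : path (step d) x s -> s != [::] ->
  ord d x (last x s).
Proof.
elim: s x => //= y s IH x /andP[xy ys] _.
have := IH _ ys; case: s ys {IH} => [|z s] ys; first by move=> _; exact: stepW.
by move=> /(_ isT); apply: ord_trans; exact: stepW.
Qed.

Lemma ord_path d x y : ord d x y ->
  exists s, [/\ path (step d) x s, last x s = y & s != [::]].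
Proof.
case: d => /= xy; have [s [ps ls]] := plt_path xy; last first.
  exists s; split=> //; apply/eqP => s0; move: xy; rewrite -ls s0 /=.
  by rewrite plt_irr.
exists (rev (belast y s)); split.
- by rewrite -ls rev_path.
- by rewrite -ls; case: s ps ls => [|z s] //= _ _; rewrite rev_cons last_rcons.
- rewrite -size_eq0 size_rev size_belast size_eq0.
  by apply/eqP => s0; move: xy; rewrite -ls s0 /= plt_irr.
Qed.

Lemma turning_point d x s : path (adjacent T) x s ->
  path (step d) x s \/
  exists s1 y s2, [/\ s = s1 ++ y :: s2, path (step d) x s1 &
                      step (~~ d) (last x s1) y].
Proof.
elim: s x => [|y s IH] x /=; first by left.
rewrite (adjacent_step d) => /andP[/orP[xy|xy] ys]; last first.
  by right; exists [::], y, s.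
have [ys'|[s1 [z [s2 [-> ps1 lz]]]]] := IH _ ys; first by left; rewrite xy.
by right; exists (y :: s1), z, s2; split=> //=; rewrite xy.
Qed.

(** A vertex that branches in direction d has its left and right branches on
its two sides.  The bound on the length of the walk serves the induction. *)
Definition one_sided N := forall d k v s, (size s < N)%N ->
  uniq (k :: v :: s) -> path (adjacent T) k (v :: s) ->
  eps k = d -> step d k v -> forall w, w \in v :: s -> (w < k) = (v < k).

(** Where a walk first turns back, both neighbours on the walk lie in the
branching direction of the turning point m, so its start and what follows m
are in different branches of m. *)
Lemma turn_separates N d x s1 y s2 : one_sided N ->
  (size s1 + size s2 <= N)%N -> s1 != [::] ->
  uniq (x :: s1 ++ y :: s2) -> path (adjacent T) x (s1 ++ y :: s2) ->
  path (step d) x s1 -> step (~~ d) (last x s1) y ->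
  forall w, w \in y :: s2 -> between (last x s1) x w.
Proof.
move=> side; case/lastP: s1 => // s1 m; rewrite size_rcons last_rcons => sz _.
rewrite cat_rcons.
move=> Ux px ps my w wy.
move: ps; rewrite rcons_path => /andP[ps zm].
move: px; rewrite cat_path /= => /and3P[px1 adj1 /andP[adj2 py]].
move: Ux; rewrite -cat_cons cat_uniq => /and3P[U1 disj U2].
set z := last x s1 in zm adj1.
have mz : step (~~ d) m z by rewrite step_rev.
have zin : z \in x :: s1 by exact: mem_last.
have zy : z != y.
  apply: contra disj => /eqP zy; apply/hasP; exists y.
    by rewrite !inE eqxx orbT.
  by rewrite /= -zy.
have [em bm] := branching mz my zy.
have fw : (w < m) = (y < m).
  apply: (side (~~ d) m y s2) => //=.
    by apply: leq_trans sz; rewrite addSn ltnS leq_addl.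
  by rewrite adj2.
have bw : (x < m) = (z < m).
  have E : rev (x :: s1) = z :: rev (belast x s1).
    by rewrite lastI rev_rcons.
  apply: (side (~~ d) m z (rev (belast x s1))) => //.
  - rewrite size_rev size_belast.
    by apply: leq_trans sz; rewrite addSn ltnS leq_addr.
  - rewrite -E -rev_rcons rev_uniq rcons_uniq U1 andbT.
    by apply: contra disj => mi; apply/hasP; exists m => //=; rewrite inE eqxx.
  - rewrite -E -[m in path _ m _](last_rcons x s1) -(belast_rcons x s1 m).
    rewrite rev_path rcons_path -/z adjacent_sym adj1 andbT.
    by rewrite (eq_path (e' := adjacent T)) // => u v; rewrite adjacent_sym.
  - by rewrite -E mem_rev inE eqxx.
have wm : w != m.
  move: U2 => /= /andP[+ _]; apply: contraNneq => <-; exact: wy.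
have xm : x != m.
  apply: contra disj => /eqP <-; apply/hasP; exists x; rewrite ?inE ?eqxx//.
move: bm bw fw wm xm; rewrite /between; clear; lia.
Qed.


Lemma path_rcons_init (e : rel int) x s y : path e x (rcons s y) -> path e x s.
Proof. by rewrite rcons_path => /andP[]. Qed.

(** A first edge straddling k could not be reached by a walk that keeps its
direction, by (T4).  After a turn, the turning point would lie between k and
the far end of that edge, and the near end would not lie on the side of k. *)
Lemma side_of_branch N : one_sided N.
Proof.
elim: N => [//|N IH] d k v s; elim/last_ind: s => [|s w IHs] sz U ps ek kv.
  by move=> w; rewrite inE => /eqP ->.
rewrite size_rcons in sz.
move: (U) (ps); rewrite -!rcons_cons rcons_uniq rcons_path.
move=> /andP[wn U'] /andP[ps' uw].
have {}IHs := IHs (ltnW sz) U' ps' ek kv.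
set u := last k (v :: s) in uw.
have uin : u \in v :: s by rewrite /u /= mem_last.
move=> w0; rewrite mem_rcons inE => /orP[/eqP {w0}->|]; last exact: IHs.
have wk : w != k.
  by apply: contraNneq wn => ->; rewrite inE eqxx.
have uk : u != k.
  by move: U' => /= /andP[+ _]; apply: contraNneq => <-.
have uvk := IHs u uin.
case: (eqVneq (w < k) (v < k)) => // wvk.
have bt : between k u w.
  by move: wvk uvk uk wk; rewrite /between; clear; lia.
have [mono|[s1 [y [s2 [E ps1 my]]]]] := turning_point d ps.
  have ku : ord d k u.
    by apply: path_step_ord => //; move: mono; rewrite -rcons_cons rcons_path
      => /andP[].
  have kw : ord d k w.
    by have := path_step_ord mono isT; rewrite /= last_rcons.
  by have := blocking uw bt ku kw; rewrite ek; case: (d).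
have s10 : s1 != [::].
  apply/eqP => s10; move: E my; rewrite s10 /= => -[<- _].
  rewrite step_rev => /stepW yk.
  by have := ord_trans yk (stepW kv); rewrite ord_irr.
have sep : forall w0, w0 \in y :: s2 -> between (last k s1) k w0.
  apply: (@turn_separates N d) => //; rewrite -?E //.
  have /(congr1 size) := E; rewrite size_cat /= size_rcons => Es.
  by move: Es; rewrite addnS => -[<-].
move: E; rewrite -rcons_cons; case/lastP: s2 sep {my} => [|s2 w'] sep.
  rewrite cats1 => /rcons_inj[E1 E2].
  move: (sep w); rewrite -E2 inE eqxx -E1 -/u => /(_ isT).
  by move: bt; rewrite /between; clear; lia.
rewrite -rcons_cons -rcons_cat => /rcons_inj[E1 E2].
have uE : u = last y s2 by rewrite /u E1 last_cat.
have := sep u; rewrite uE -rcons_cons mem_rcons inE (mem_last y s2) orbT -uE.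
move=> /(_ isT); have := sep w; rewrite -E2 inE mem_rcons inE eqxx orbT.
by move=> /(_ isT); move: bt; rewrite /between; clear; lia.
Qed.

(** On a walk from k to the nearer end of the edge, a first step in the
branching direction of k would confine the walk to one side of k, and a later
turn would leave both ends of the edge on one side of the turning point and k
on the other. *)
Lemma edge_side a b k : adjacent T a b -> between k a b ->
  ord (~~ eps k) k a \/ ord (~~ eps k) k b.
Proof.
set d := eps k => ab bt.
(* Stop the walk at the first end of the edge, and append the other end y. *)
have [p [y [Up pp ly [lp yb]]]] : exists p : seq int, exists y : int,
    [/\ uniq (k :: rcons p y), path (adjacent T) k (rcons p y),
        between k (last k p) y &
        p != [::] /\ (ord (~~ d) k (last k p) ->
        ord (~~ d) k a \/ ord (~~ d) k b)].
  have [s [ps ls]] := tree_connected T k a.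
  have ka : k != a by move: bt; rewrite /between; clear; lia.
  have kb : k != b by move: bt; rewrite /between; clear; lia.
  have {ls s ps} [p [pp Up lp]] : exists p, [/\ path (adjacent T) k p,
      uniq (k :: p) & last k p = a].
    by move: ls; case/shortenP: ps => p pp Up _ lp; exists p.
  have p0 : p != [::] by apply: contraNneq ka => p0; rewrite -lp p0.
  have [bp|bp] := boolP (b \in p); last first.
    exists p, b; rewrite lp; split=> //; last by split=> // ?; left.
      by rewrite -rcons_cons rcons_uniq Up andbT inE negb_or bp andbT eq_sym.
    by rewrite rcons_path pp lp.
  case/path.splitP: bp pp Up lp {p0} => p1 p2.
  rewrite cat_path last_cat last_rcons => /andP[pp1 _].
  rewrite -cat_cons cat_uniq => /and3P[U1 disj _] lp.
  have p20 : p2 != [::].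
    by move/adjacent_neq: ab => + ; apply: contraNneq => p20; rewrite -lp p20.
  have ap2 : a \in p2.
    by case: p2 p20 lp {disj} => //= z p2 _ <-; rewrite mem_last.
  exists (rcons p1 b), a; rewrite last_rcons; split=> //.
  - rewrite -rcons_cons rcons_uniq U1 andbT.
    by apply: contra disj => ain; apply/hasP; exists a.
  - by rewrite rcons_path pp1 last_rcons adjacent_sym.
  - by move: bt; rewrite /between; clear; lia.
  - by split; [case: (p1) | right].
have [mono|[s1 [z [s2 [E ps1 mz]]]]] :=
    turning_point (~~ d) (path_rcons_init pp).
  by apply: yb; exact: path_step_ord.
rewrite negbK in mz.
have Ep : rcons p y = s1 ++ z :: rcons s2 y by rewrite E -cats1 -catA cats1.
have xin : last k p \in z :: rcons s2 y.
  by rewrite E last_cat /= -rcons_cons mem_rcons inE mem_last orbT.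
have yin : y \in z :: rcons s2 y.
  by rewrite inE mem_rcons inE eqxx orbT.
rewrite Ep in Up pp.
case: (eqVneq s1 [::]) => [s10|s10].
  (* The walk starts in the branching direction, so it stays on one side. *)
  rewrite s10 /= in Up pp mz.
  have side := side_of_branch (ltnSn _) Up pp (erefl d) mz.
  move: bt (side _ xin) (side _ yin) ly; rewrite /between; clear; lia.
have sep := turn_separates (@side_of_branch _) (leqnn _) s10 Up pp ps1.
rewrite negbK in sep.
move: (sep mz _ xin) (sep mz _ yin) ly; rewrite /between; clear; lia.
Qed.

Lemma uniq_step m a c :
  step (~~ eps m) m a -> step (~~ eps m) m c -> a = c.
Proof.
move=> ma mc; apply/eqP; apply: contraT => ac.
by have [+ _] := branching ma mc ac; case: (eps m).
Qed.

Lemma ord_uniq_step m a w : step (~~ eps m) m a -> ord (~~ eps m) m w ->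
  w = a \/ ord (~~ eps m) a w.
Proof.
move=> ma /ord_path[[|z s] [//= /andP[mz ps] lz _]].
have za := uniq_step mz ma; rewrite {z}za in mz ps lz.
case: s ps lz => [|z s] ps lz; first by left.
by right; rewrite -lz; exact: path_step_ord.
Qed.
End Sides.

(** * Edges of periodic trees are real Schur pairs *)

Lemma periodic_sign_shift n eps (s i : int) : periodic_sign n eps ->
  eps (i + s * n%:Z) = eps i.
Proof.
move=> per; elim/int_ind: s => [|s IH|s IH].
- by rewrite mul0r addr0.
- rewrite -IH -[RHS]per; congr eps; lia.
- rewrite -IH -[LHS]per; congr eps; lia.
Qed.

Lemma exists_sign_within n eps b (i : int) : (0 < n)%N ->
  periodic_sign n eps -> surjective_sign eps ->
  exists m, [/\ i <= m, m < i + n%:Z & eps m = b].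
Proof.
move=> n0 per surj; have [m em] := surj b.
exists (i + ((m - i) %% n%:Z)%Z); split.
- by rewrite lerDl modz_ge0 //; lia.
- by rewrite ltrD2l ltz_pmod //; lia.
- rewrite -em -(periodic_sign_shift (- ((m - i) %/ n%:Z)%Z) m per); congr eps.
  have := divz_eq (m - i) n%:Z; lia.
Qed.

Section RealSchur.
Variables (n : nat) (eps : int -> bool) (T : periodic_tree n eps).
Hypotheses (n_gt0 : (0 < n)%N) (per : periodic_sign n eps).
Hypothesis surj : surjective_sign eps.
Local Notation step := (step T).
Local Notation ord := (ord T).

Lemma child_shift p q : child T (p + n%:Z) (q + n%:Z) = child T p q.
Proof.
apply/idP/idP => /asboolP[pq no]; apply/asboolP; split.
- by rewrite plt_periodic.
- by move=> [x [px xq]]; apply: no; exists (x + n%:Z); rewrite -!plt_periodic.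
- by rewrite -plt_periodic.
- move=> [x [px xq]]; apply: no; exists (x - n%:Z).
  by split; rewrite plt_periodic subrK.
Qed.

Lemma step_shift d p q : step d (p + n%:Z) (q + n%:Z) = step d p q.
Proof. by case: d => /=; rewrite child_shift. Qed.

Lemma step_shift_multiple (s : int) d p q :
  step d (p + s * n%:Z) (q + s * n%:Z) = step d p q.
Proof.
elim/int_ind: s => [|s IH|s IH]; first by rewrite mul0r !addr0.
- by rewrite -IH -[RHS]step_shift; congr (step d _ _); clear; lia.
- by rewrite -IH -[LHS]step_shift; congr (step d _ _); clear; lia.
Qed.

(** In the direction where the vertices of the sign of i do not branch, the
translates of i would form an infinite chain.  It could not be left, although
[edge_side] makes it lead to a vertex of the opposite sign. *)
Lemma no_edge_period i : ~ adjacent T i (i + n%:Z).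
Proof.
move=> ed; set b := eps i.
have [m [im mi em]] := exists_sign_within (~~ b) i n_gt0 per surj.
have im' : i != m.
  by apply/eqP => E; move: em; rewrite -E -/b; case: (b).
have bt : between m i (i + n%:Z).
  by move: im mi im'; rewrite /between; clear; lia.
have side := edge_side ed bt; rewrite em negbK in side.
(* The constant c = 1 or -1 is the direction in which the chain runs. *)
suff noway (c : int) x : (c = 1 \/ c = -1) -> step (~~ b) i (i + c * n%:Z) ->
    ord (~~ b) (i + x * n%:Z) m -> False.
  move: side ed; rewrite -!(ord_rev T b _ m) (adjacent_step T (~~ b)) negbK.
  move=> side.
  have side' : exists x, ord (~~ b) (i + x * n%:Z) m.
    case: side => side; first by exists 0; rewrite mul0r addr0.
    by exists 1; rewrite mul1r.
  case: side' => x ox /orP[up|down].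
    by apply: (noway 1 x); rewrite ?mul1r //; left.
  apply: (noway (-1) x) => //; first by right.
  have := down; rewrite -step_rev -(step_shift_multiple (-1)).
  by congr (step _ _ _); clear; lia.
move=> c1 up /ord_path[s [ps ls _]].
have : exists y, m = i + y * n%:Z.
  rewrite -ls; elim: s x ps {ls} => [|z s IH] x /=; first by exists x.
  move=> /andP[xz zs].
  have ex : eps (i + x * n%:Z) = b by rewrite periodic_sign_shift.
  have zE : z = i + (x + c) * n%:Z.
    rewrite -ex in xz up.
    rewrite -(step_shift_multiple x) in up.
    by rewrite (uniq_step xz up); clear; lia.
  by rewrite zE; apply: IH; rewrite -zE.
case=> y mE; move: em; rewrite mE periodic_sign_shift // -/b.
by case: (b).
Qed.

(** If i and j had the same sign and j were beyond i + n, then i + n would lie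
between i and j, and j between i + n and j + n.  Comparing the edge with its
translate by [edge_side], unique steps produce a cycle in the poset. *)
Lemma edge_real_schur i j : is_edge T i j -> real_schur_pair n eps i j.
Proof.
move=> [ij ed]; split=> //.
case: (eqVneq (eps i) (eps j)) => [eij|]; last by left.
right; split=> //; case: (ltgtP j (i + n%:Z)) => // [jn|jn]; last first.
  by move: ed; rewrite jn => /no_edge_period.
exfalso; set b := eps i.
have ed' : adjacent T (i + n%:Z) (j + n%:Z) by rewrite /adjacent !child_shift.
have side1 := @edge_side _ _ _ _ _ (i + n%:Z) ed.
have side2 := @edge_side _ _ _ _ _ j ed'.
rewrite per -/b in side1; rewrite -eij -/b in side2.
have {}side1 := side1 ltac:(by move: jn n_gt0; rewrite /between; clear; lia).
have {}side2 := side2 ltac:(by move: jn n_gt0; rewrite /between; clear; lia).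
move: (ed); rewrite (adjacent_step T (~~ b)) negbK => /orP[up|down].
  have up' : step (~~ b) (i + n%:Z) (j + n%:Z) by rewrite step_shift.
  have o1 : ord (~~ b) (i + n%:Z) j.
    by case: side1 => // o; exact: ord_trans o (stepW up).
  have bE : b = eps (i + n%:Z) by rewrite per.
  have o2 : ord (~~ b) (j + n%:Z) j.
    rewrite bE in up' o1 *.
    case: (ord_uniq_step up' o1) => // jE.
    by move: n_gt0 jE; clear; lia.
  case: side2 => o.
    by have := ord_trans o o1; rewrite ord_irr.
  by have := ord_trans o o2; rewrite ord_irr.
rewrite -step_rev in down.
have down' : step (~~ b) (j + n%:Z) (i + n%:Z) by rewrite step_shift.
have o1 : ord (~~ b) (i + n%:Z) i.
  by case: side1 => // o; exact: ord_trans o (stepW down).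
have o2 : ord (~~ b) j (i + n%:Z).
  by case: side2 => // o; exact: ord_trans o (stepW down').
have bE : b = eps j by [].
have o3 : ord (~~ b) i (i + n%:Z).
  rewrite bE in down o2 *.
  case: (ord_uniq_step down o2) => // jE.
  by move: n_gt0 jE; clear; lia.
by have := ord_trans o1 o3; rewrite ord_irr.
Qed.
End RealSchur.

(** * The tree of a height function *)

Section Visible.
Variables (eps : int -> bool) (H : int -> int).

(** Walls hang down from the points of sign + and rise from those of sign -;
no wall at an index between p and q may enter the strip of heights between
them. *)
Definition visible (p q : int) : Prop := H p < H q /\
  forall k, between k p q -> if eps k then H k < H p else H q < H k.

Definition height_lt : rel int := fun p q => `[< clos_trans int visible p q >].

Lemma visible_lt p q : visible p q -> height_lt p q.
Proof. by move=> v; apply/asboolP; exact: t_step. Qed.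

Lemma height_lt_trans : transitive height_lt.
Proof.
move=> y x z /asboolP xy /asboolP yz; apply/asboolP; exact: t_trans xy yz.
Qed.

Lemma height_ltW p q : height_lt p q -> H p < H q.
Proof.
move=> /asboolP; elim=> [x y []//|x y z _ xy _ yz]; exact: lt_trans xy yz.
Qed.

Lemma child_visible p q : child height_lt p q -> visible p q.
Proof.
move=> /asboolP[/asboolP pq no]; case: pq no => // y z /asboolP xy /asboolP yz.
by case; exists y.
Qed.

Lemma height_lt_path p q : height_lt p q ->
  exists s, path (child height_lt) p s /\ last p s = q.
Proof.
have [N] := ubnP `|H q - H p|%N; elim: N p q => [//|N IH] p q sz pq.
have [[x [px xq]]|no] := pselect (exists x, height_lt p x /\ height_lt x q);
  last by exists [:: q] => /=; rewrite andbT; split=> //; apply/asboolP.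
have hp := height_ltW px; have hq := height_ltW xq.
have [|s [ps ls]] := IH p x _ px; first by move: hp hq sz; clear; lia.
have [|t [pt lt]] := IH x q _ xq; first by move: hp hq sz; clear; lia.
by exists (s ++ t); rewrite cat_path last_cat ls ps pt lt.
Qed.

Hypothesis H_inj : injective H.

(** Climb from p to the lowest obstacle of sign -, which sees p, and go on
from there. *)
Lemma climb p q : H p < H q ->
  (forall k, between k p q -> if eps k then H k < H p else H p < H k) ->
  height_lt p q.
Proof.
have [N] := ubnP `|H q - H p|%N; elim: N p q => [//|N IH] p q sz pq bt.
pose P (m : nat) := `[< exists k, [/\ between k p q, ~~ eps k, H k <= H q &
  H k = H p + m%:Z] >].
have [exP|noP] := pselect (exists m, P m); last first.
  apply: visible_lt; split=> // k kb; have := bt k kb.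
  case: ifPn => // ek pk; rewrite ltNge; apply/negP => kq; apply: noP.
  exists `|H k - H p|%N; apply/asboolP; exists k; split=> //.
  by move: pk; clear; lia.
case: (ex_minnP exP) => m /asboolP[k [kb ek kq km]] min.
have pk : H p < H k by have := bt k kb; rewrite (negbTE ek).
have low x : between x p q -> ~~ eps x -> H k <= H x.
  move=> xb ex; rewrite leNgt; apply/negP => xk.
  have px : H p < H x by have := bt x xb; rewrite (negbTE ex).
  have := min `|H x - H p|%N; have -> : P `|H x - H p|%N.
    apply/asboolP; exists x; split=> //.
      by apply: ltW; exact: lt_le_trans xk kq.
    by move: px; clear; lia.
  by move=> /(_ isT); move: px xk km; clear; lia.
have strict x y : x != y -> H x <= H y -> H x < H y.
  by move=> xy; rewrite lt_neqAle => ->; rewrite (inj_eq H_inj) xy.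
have pvk : height_lt p k.
  apply: visible_lt; split=> // x xb.
  have xb' : between x p q by move: xb kb; rewrite /between; clear; lia.
  have := bt x xb'; case: ifPn => // ex _.
  by apply: strict (low _ xb' ex); move: xb; rewrite /between; clear; lia.
have kq' : H k < H q by apply: strict kq; move: kb; rewrite /between; clear; lia.
apply: height_lt_trans pvk _; apply: IH => //.
  by move: sz pk kq' pq; clear; lia.
move=> x xb; have xb' : between x p q by move: xb kb; rewrite /between; clear; lia.
have := bt x xb'; case: ifPn => [ex xp|ex _]; first exact: lt_trans xp pk.
by apply: strict (low _ xb' ex); move: xb; rewrite /between; clear; lia.
Qed.

(** Unless p has sign - and lies between them, the lower of two parents of p
would be below the higher one. *)
Lemma two_parents p q q' : child height_lt p q -> child height_lt p q' ->
  q != q' -> eps p = false /\ between p q q'.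
Proof.
wlog qq' : q q' / H q < H q' => [wl pq pq' ne|].
  have [h|h] := boolP (H q < H q'); first exact: wl.
  have h' : H q' < H q.
    by rewrite lt_neqAle (inj_eq H_inj) eq_sym ne leNgt.
  have [|ep b] := wl q' q h' pq' pq; first by rewrite eq_sym.
  by split=> //; move: b; rewrite /between orbC.
move=> pq pq' ne.
have [hpq vq] := child_visible pq; have [_ vq'] := child_visible pq'.
case: (boolP (~~ eps p && between p q q')) => [/andP[/negbTE]//|nb].
have qlt : height_lt q q'.
  apply: climb => // k kb.
  case: (eqVneq k p) => [kp|kp].
    move: kb nb; rewrite kp => ->; rewrite andbT negbK => ->.
    exact: hpq.
  case: (boolP (between k p q)) => [kpq|kpq].
    by have := vq k kpq; case: ifP => // _ h; exact: lt_trans h hpq.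
  have kpq' : between k p q'.
    by move: kb kpq kp; rewrite /between; clear; lia.
  have := vq' k kpq'; case: ifP => _ h; first exact: lt_trans h hpq.
  exact: lt_trans qq' h.
by move: pq' => /asboolP[_ []]; exists q; split=> //; move/asboolP: pq => [].
Qed.
End Visible.

(** Turning the picture upside down exchanges the two kinds of walls. *)
Lemma height_lt_dual eps H p q :
  height_lt (negb \o eps) (fun k => - H k) q p = height_lt eps H p q.
Proof.
have vis_dual e h x y : visible e h x y ->
    visible (negb \o e) (fun k => - h k) y x.
  case=> xy vis; split=> [|k]; rewrite /= ?ltrN2 //.
  by rewrite /between orbC => /vis /=; case: (e k).
have dual e h x y : height_lt e h x y ->
    height_lt (negb \o e) (fun k => - h k) y x.
  move=> /asboolP xy; apply/asboolP; elim: xy => [u v uv|u v w _ uv _ vw].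
    by apply: t_step; exact: vis_dual.
  exact: t_trans vw uv.
apply/idP/idP => [/dual|]; last exact: dual.
congr (height_lt _ _ _ _ : Prop).
- by apply/funext => k /=; rewrite negbK.
- by apply/funext => k /=; rewrite opprK.
Qed.

Lemma two_children eps H p q q' : injective H ->
  child (height_lt eps H) q p -> child (height_lt eps H) q' p ->
  q != q' -> eps p = true /\ between p q q'.
Proof.
move=> H_inj.
have dual x y : child (height_lt eps H) x y ->
    child (height_lt (negb \o eps) (fun k => - H k)) y x.
  move=> /asboolP[xy no]; apply/asboolP; rewrite height_lt_dual; split=> //.
  by move=> [z]; rewrite !height_lt_dual => -[yz zx]; apply: no; exists z.
move=> /dual qp /dual q'p ne.
have [|ep b] := two_parents _ qp q'p ne; first by move=> x y /oppr_inj /H_inj.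
by split=> //; apply/negbFE.
Qed.

Lemma height_lt_shift eps H (d D : int) p q :
  (forall k, eps (k + d) = eps k) -> (forall k, H (k + d) = H k + D) ->
  height_lt eps H p q -> height_lt eps H (p + d) (q + d).
Proof.
move=> per Hd /asboolP pq; apply/asboolP.
elim: pq => [x y [xy vis]|x y z _ xy _ yz]; last exact: t_trans xy yz.
apply: t_step; split=> [|k kb]; first by rewrite !Hd ltrD2r.
have kd := Hd (k - d); have ek := per (k - d); rewrite subrK in kd ek.
have := vis (k - d); rewrite kd ek !Hd !ltrD2r; apply.
by move: kb; rewrite /between; clear; lia.
Qed.

Lemma straddling_edge (e : rel int) m x s : path e x s -> m \notin x :: s ->
  between m x (last x s) ->
  exists u v, [/\ u \in x :: s, v \in x :: s, e u v & between m u v].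
Proof.
elim: s x => [|y s IH] x /=; first by move=> _ _; rewrite /between; clear; lia.
move=> /andP[xy ys]; rewrite inE negb_or => /andP[mx my] bt.
have [b|nb] := boolP (between m x y).
  by exists x, y; rewrite !inE !eqxx ?orbT.
have [|u [v [us vs uv b]]] := IH y ys my.
  have : m != y by move: my; rewrite inE negb_or => /andP[].
  by move: bt nb mx; rewrite /between; clear; lia.
by exists u, v; split=> //; rewrite in_cons ?us ?vs orbT.
Qed.

Lemma lowest_vertex (H : int -> int) (c : seq int) : c != [::] ->
  exists2 m, m \in c & forall x, x \in c -> H m <= H x.
Proof.
elim: c => // y c IH _; case: (eqVneq c [::]) => [->|/IH[m mc min]].
  by exists y; rewrite ?inE // => x; rewrite inE => /eqP->.
have [ym|my] := leP (H y) (H m).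
  exists y; first by rewrite inE eqxx.
  by move=> x; rewrite inE => /orP[/eqP->//|/min]; exact: le_trans.
exists m; first by rewrite inE mc orbT.
by move=> x; rewrite inE => /orP[/eqP->|/min//]; exact: ltW.
Qed.

Section HeightTree.
Variables (n : nat) (eps : int -> bool) (H : int -> int) (C : int).
Hypotheses (per : periodic_sign n eps) (H_inj : injective H).
Hypothesis H_per : forall k, H (k + n%:Z) = H k + C.
Local Notation lt := (height_lt eps H).

Lemma height_lt_irr : irreflexive lt.
Proof. by move=> p; apply/negP => /height_ltW; rewrite ltxx. Qed.

Lemma height_lt_periodic i j : lt i j = lt (i + n%:Z) (j + n%:Z).
Proof.
apply/idP/idP; first exact: height_lt_shift.
move=> /(@height_lt_shift _ _ (- n%:Z) (- C)); rewrite !addrK; apply => k.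
  by rewrite -per subrK.
by apply/eqP; rewrite eq_sym subr_eq -H_per subrK.
Qed.

Definition height_poset : periodic_poset n :=
  PeriodicPoset height_lt_irr (@height_lt_trans eps H) height_lt_periodic
    (@height_lt_path eps H).

Lemma adjacent_visible p q : adjacent lt p q ->
  visible eps H p q \/ visible eps H q p.
Proof. by case/orP => /child_visible; [left | right]. Qed.

Lemma path_undirect p s : path (child lt) p s -> path (adjacent lt) p s.
Proof. by apply: sub_path => x y xy; rewrite /adjacent xy. Qed.

(** Neighbouring integers see each other, so they are comparable. *)
Lemma height_connected : connected_graph lt.
Proof.
have sym x s : path (adjacent lt) x s ->
    path (adjacent lt) (last x s) (rev (belast x s)).
  by rewrite rev_path; apply: sub_path => u v; rewrite /adjacent orbC.
have join p q r :
    (exists s, path (adjacent lt) p s /\ last p s = q) ->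
    (exists s, path (adjacent lt) q s /\ last q s = r) ->
    exists s, path (adjacent lt) p s /\ last p s = r.
  move=> [s [ps ls]] [t [pt lt]]; exists (s ++ t).
  by rewrite cat_path last_cat ls ps pt lt.
have back p q : (exists s, path (adjacent lt) p s /\ last p s = q) ->
    exists s, path (adjacent lt) q s /\ last q s = p.
  move=> [s [ps ls]]; exists (rev (belast p s)); rewrite -ls; split; first exact: sym.
  by case: s {ps ls} => //= z s; rewrite rev_cons last_rcons.
have next p : exists s, path (adjacent lt) p s /\ last p s = p + 1.
  have vis x y : H x < H y -> `|x - y|%N = 1%N -> lt x y.
    move=> xy d; apply: visible_lt; split=> // k.
    by move: d; rewrite /between; clear; lia.
  have [h|h] := boolP (H p < H (p + 1)).
    have [|s [ps ls]] := @height_lt_path eps H p (p + 1).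
      by apply: vis => //; clear; lia.
    by exists s; split=> //; exact: path_undirect.
  apply: back; have [|s [ps ls]] := @height_lt_path eps H (p + 1) p.
    apply: vis; last by clear; lia.
    by rewrite lt_neqAle (inj_eq H_inj) leNgt h andbT; clear; lia.
  by exists s; split=> //; exact: path_undirect.
have up p (m : nat) : exists s, path (adjacent lt) p s /\ last p s = p + m%:Z.
  elim: m => [|m IH]; first by exists [::]; rewrite addr0.
  have -> : p + m.+1%:Z = p + m%:Z + 1 by clear; lia.
  exact: join IH (next _).
move=> p q; have [pq|/ltW qp] := leP p q.
  by have -> : q = p + `|q - p|%N%:Z by move: pq; clear; lia.
apply: back; have := up q `|p - q|%N.
by have <- : p = q + `|p - q|%N%:Z by move: qp; clear; lia.
Qed.

(** At the lowest vertex of a cycle both neighbours are parents, so its sign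
is -.  The rest of the cycle leads from one side of its wall to the other, above
its height. *)
Lemma height_acyclic : acyclic_graph lt.
Proof.
move=> c Uc cyc; rewrite leqNgt; apply/negP => sz.
have [|m mc min] := @lowest_vertex H c; first by case: (c) sz.
have [i s Ec] := rot_to mc.
have Us : uniq (m :: s) by rewrite -Ec rot_uniq.
have cs : cycle (adjacent lt) (m :: s) by rewrite -Ec rot_cycle.
have {}min x : x \in m :: s -> H m <= H x by rewrite -Ec mem_rot; exact: min.
have {}sz : (2 < size (m :: s))%N by rewrite -Ec size_rot.
case/lastP: s Us cs min sz {Ec} => // s z; case: s => // a s.
rewrite /= !rcons_path last_rcons !inE !negb_or mem_rcons inE negb_or.
move=> /and3P[/and3P[ma mz ms] + Us] /and3P[adj_a ps adj_z] min _.
rewrite mem_rcons inE negb_or => /andP[az as_].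
have par x : x != m -> adjacent lt m x -> H m <= H x -> child lt m x.
  move=> xm /orP[//|/child_visible[+ _]] mx.
  by rewrite ltNge mx.
have ca : child lt m a.
  by apply: par => //; [rewrite eq_sym | apply: min; rewrite !inE eqxx orbT].
have cz : child lt m z.
  apply: par; first by rewrite eq_sym.
    by rewrite /adjacent orbC.
  by apply: min; rewrite !inE mem_rcons inE eqxx !orbT.
have [em bm] := two_parents H_inj ca cz az.
have [|||u [v [us vs uv b]]] := @straddling_edge (adjacent lt) m a (rcons s z).
- by rewrite rcons_path.
- by rewrite inE mem_rcons inE !negb_or ma mz.
- by rewrite last_rcons.
have hu : H m <= H u by apply: min; rewrite inE us orbT.
have hv : H m <= H v by apply: min; rewrite inE vs orbT.
case: (adjacent_visible uv) => -[_ vis].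
  by have := vis m b; rewrite em ltNge hv.
have := vis m; rewrite /between orbC -/(between m u v) => /(_ b).
by rewrite em ltNge hu.
Qed.

Lemma height_T4 i j k : is_edge lt i j -> i < k -> k < j ->
  (lt k i -> lt k j -> eps k = true) /\ (lt i k -> lt j k -> eps k = false).
Proof.
move=> [_ ij] ik kj; split=> /height_ltW hi /height_ltW hj.
- case: (adjacent_visible ij) => -[h /(_ k)]; rewrite /between ik kj ?orbT;
  move=> /(_ isT); case: ifP => // _ h'.
    by have := lt_trans h' hj; rewrite ltxx.
  by have := lt_trans h' hi; rewrite ltxx.
- case: (adjacent_visible ij) => -[h /(_ k)]; rewrite /between ik kj ?orbT;
  move=> /(_ isT); case: ifP => // _ h'.
    by have := lt_trans h' hi; rewrite ltxx.
  by have := lt_trans h' hj; rewrite ltxx.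
Qed.

Lemma subset1_of_neq (A : set int) :
  (forall x y, A x -> A y -> x != y -> False) -> is_subset1 A.
Proof. by move=> h x y Ax Ay; apply/eqP/negPn/negP => /(h x y Ax Ay). Qed.

Lemma height_T2 i : eps i = true -> is_subset1 (parents lt i).
Proof.
move=> ei; apply: subset1_of_neq => x y px py xy.
by have [] := two_parents H_inj px py xy; rewrite ei.
Qed.

Lemma height_T3 i : eps i = false -> is_subset1 (children lt i).
Proof.
move=> ei; apply: subset1_of_neq => x y px py xy.
by have [] := two_children H_inj px py xy; rewrite ei.
Qed.

Lemma height_T1 i :
  [/\ is_subset1 (left_parents lt i), is_subset1 (right_parents lt i),
      is_subset1 (left_children lt i) & is_subset1 (right_children lt i)].
Proof.
split; apply: subset1_of_neq => x y [px ix] [py iy] xy.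
- have [_] := two_parents H_inj px py xy; move: ix iy.
  by rewrite /between; clear; lia.
- have [_] := two_parents H_inj px py xy; move: ix iy.
  by rewrite /between; clear; lia.
- have [_] := two_children H_inj px py xy; move: ix iy.
  by rewrite /between; clear; lia.
- have [_] := two_children H_inj px py xy; move: ix iy.
  by rewrite /between; clear; lia.
Qed.

Definition height_tree : periodic_tree n eps :=
  @PeriodicTree n eps height_poset height_connected height_acyclic
    height_T1 height_T2 height_T3 height_T4.

(** No vertex fits between consecutive heights. *)
Lemma height_tree_edge i j : i < j -> visible eps H i j -> H j = H i + 1 ->
  is_edge height_tree i j.
Proof.
move=> ij vis hij; split=> //; apply/orP; left; apply/asboolP; split.
  exact: visible_lt.
by move=> [x [/height_ltW ix /height_ltW xj]]; move: ix xj hij; clear; lia.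
Qed.
End HeightTree.

(** * The Euler form in terms of periodic functions *)

Section Vertices.
Variables (n : nat) (n_gt0 : (0 < n)%N).

Lemma period_neq0 : n%:Z != 0.
Proof. by rewrite eqz_nat -lt0n. Qed.

Lemma vertex_subproof (k : int) : (`|((k - 1) %% n%:Z)%Z| < n)%N.
Proof.
have := ltz_mod (k - 1) period_neq0; have := modz_ge0 (k - 1) period_neq0.
by clear; lia.
Qed.

Definition vertex (k : int) : 'I_n := Ordinal (vertex_subproof k).

Lemma vertexE k : exists s : int, k = (vertex k).+1%:Z + s * n%:Z.
Proof.
exists ((k - 1) %/ n%:Z)%Z => /=.
move: (divz_eq (k - 1) n%:Z) (modz_ge0 (k - 1) period_neq0).
set r := modz _ _; set q := divz _ _ * _; clearbody r q.
by clear; lia.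
Qed.

Lemma at_vertexE (k : int) (v : 'I_n) : at_vertex k v = (v == vertex k).
Proof.
rewrite /at_vertex; have [s {1}->] := vertexE k.
rewrite addrC modzMDl !intS eqz_modDl !modz_nat eqz_nat.
by rewrite !modn_small // eq_sym.
Qed.

Lemma vertex_ord (v : 'I_n) : vertex v.+1%:Z = v.
Proof. by apply/eqP; rewrite eq_sym -at_vertexE /at_vertex. Qed.

Lemma vertex_period k : vertex (k + n%:Z) = vertex k.
Proof.
apply/eqP; rewrite eq_sym -at_vertexE /at_vertex modzDr.
by rewrite -/(at_vertex k (vertex k)) at_vertexE.
Qed.

Lemma periodic_vertex (A : Type) (f : int -> A) k :
  (forall i, f (i + n%:Z) = f i) -> f (vertex k).+1%:Z = f k.
Proof.
move=> per; have [s {2}->] := vertexE k.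
elim/int_ind: s => [|s IH|s IH]; first by rewrite mul0r addr0.
- rewrite IH -[LHS]per; congr f; clear; lia.
- rewrite IH -[RHS]per; congr f; clear; lia.
Qed.

Lemma sum_at_vertex (R : pzRingType) (f : int -> R) k :
  (forall i, f (i + n%:Z) = f i) ->
  \sum_(w < n) (at_vertex k w)%:R * f w.+1%:Z = f k.
Proof.
move=> per; rewrite (bigD1 (vertex k)) //= at_vertexE eqxx mul1r.
rewrite big1 ?addr0; last first.
  by move=> w; rewrite at_vertexE => /negbTE ->; rewrite mul0r.
exact: periodic_vertex.
Qed.

Variable R : realType.

Lemma pairing_beta (pi : int -> R) a b : periodic_function n pi -> a <= b ->
  ((increments n pi)^T *m beta_real R n a b) 0 0 = pi b - pi a.
Proof.
move=> per ab; rewrite mxE.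
have E w : (increments n pi)^T 0 w * beta_real R n a b w 0 =
    \sum_(m < `|b - a|%N) (at_vertex (a + 1 + m%:Z) w)%:R *
      (pi w.+1%:Z - pi (w.+1%:Z - 1)).
  rewrite !mxE summxE rmorph_sum mulr_sumr; apply: eq_bigr => m _.
  rewrite mxE mulrC rmorph_nat; congr (_ * (_ - pi _)).
  by clear; lia.
rewrite (eq_bigr _ (fun w _ => E w)) exchange_big /=.
under eq_bigr => m _.
  rewrite (sum_at_vertex (f := fun k => pi k - pi (k - 1))); last first.
    by move=> i; have := per i (i - 1); rewrite addrAC; lra.
  have -> : a + 1 + m%:Z - 1 = a + m%:Z by clear; lia.
  have -> : a + 1 + m%:Z = a + m.+1%:Z by clear; lia.
  over.
rewrite -(big_mkord xpredT (fun m => pi (a + m.+1%:Z) - pi (a + m%:Z))).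
rewrite telescope_sumr // addr0; congr (pi _ - _).
by move: ab; clear; lia.
Qed.
Lemma exists_periodic_function (y : 'cV[R]_n) :
  exists2 pi : int -> R, periodic_function n pi & increments n pi = y.
Proof.
pose c := \sum_(m < n) y m 0.
pose part (r : int) := \sum_(m < n | m%:Z < r) y m 0.
pose pi (k : int) := (k %/ n%:Z)%Z%:~R * c + part (k %% n%:Z)%Z.
have pi_per k : pi (k + n%:Z) = pi k + c.
  rewrite /pi modzDr divzDr ?dvdzz // divzz period_neq0 //.
  by rewrite intrD mulrDl mul1r addrAC.
exists pi; first by move=> i j; rewrite !pi_per; ring.
apply/colP => v; rewrite mxE.
have n0 := period_neq0.
have small (r : nat) : (r < n)%N -> pi r = part r.
  move=> rn; rewrite /pi divz_nat modz_nat divn_small // modn_small //.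
  by rewrite mul0r add0r.
have part_step : part v.+1 = part v + y v 0.
  rewrite /part (bigD1 v) //=; last by clear; lia.
  rewrite addrC; congr (_ + _); apply: eq_bigl => m.
  rewrite -val_eqE /=; clear; lia.
have -> : pi v.+1 = part v.+1.
  have := ltn_ord v; rewrite leq_eqVlt => /orP[/eqP vn|]; last exact: small.
  rewrite /pi vn divzz modzz n0 mul1r.
  rewrite [part 0]big1 ?addr0; last by move=> m; clear; lia.
  by apply: eq_bigl => m; have := ltn_ord m; clear; lia.
by rewrite part_step small // addrC addKr.
Qed.
End Vertices.

Section Euler.
Variables (n : nat) (eps : int -> bool).
Hypotheses (n_ge2 : (2 <= n)%N) (per : periodic_sign n eps).
Hypothesis surj : surjective_sign eps.

Let n_gt0 : (0 < n)%N := ltnW n_ge2.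

Lemma num_arrows_loop (v : 'I_n) : num_arrows eps v v = 0%N.
Proof.
apply/eqP; rewrite cards_eq0; apply/eqP/setP => q; rewrite !inE.
have nloop : ~ (at_vertex q.+1%:Z v && at_vertex q.+2%:Z v).
  rewrite /at_vertex => /andP[/eqP <-].
  rewrite -[q.+1%:Z]addr0 -[q.+2%:Z](_ : q.+1%:Z + 1 = _); last by clear; lia.
  rewrite eqz_modDl -[0]/(0%N%:Z) -[1]/(1%N%:Z) !modz_nat eqz_nat.
  by rewrite !modn_small.
rewrite /arrow_source /arrow_target; apply/negP.
by case: (eps _) => /andP[a b]; case: nloop; rewrite a b.
Qed.

Lemma mul_euler_matrix (R : comPzRingType) (f : int -> R) (w : 'I_n) :
  (forall k, f (k + n%:Z) = f k) ->
  ((\row_v f v.+1%:Z) *m euler_matrix n eps R) 0 w =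
    f w.+1%:Z - (eps w.+1%:Z)%:R * f w.+2%:Z - (~~ eps w)%:R * f w.
Proof.
move=> fper; rewrite mxE.
have E v : (\row_u f u.+1%:Z) 0 v * euler_matrix n eps R v w =
    (at_vertex w.+1 v)%:R * f v.+1%:Z -
    \sum_(q < n) ((at_vertex (arrow_target eps q) w)%:R *
       ((at_vertex (arrow_source eps q) v)%:R * f v.+1%:Z)).
  rewrite !mxE (at_vertexE n_gt0) vertex_ord.
  have -> : (if v == w then 1 else - (num_arrows eps v w)%:R) =
      (v == w)%:R - (num_arrows eps v w)%:R :> R.
    by case: eqVneq => [->|_]; rewrite ?num_arrows_loop ?subr0 ?sub0r.
  rewrite mulrBr [_ * (_ == _)%:R]mulrC; congr (_ - _).
  rewrite /num_arrows -sum1_card big_mkcond natr_sum mulr_sumr.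
  apply: eq_bigr => q _; rewrite inE mulrA -natrM mulnb andbC mulrC.
  by case: (_ && _).
rewrite (eq_bigr _ (fun v _ => E v)) sumrB (sum_at_vertex n_gt0) //.
rewrite -addrA -opprD; congr (_ - _); rewrite exchange_big /=.
under eq_bigr do rewrite -mulr_sumr (sum_at_vertex n_gt0) //.
have E2 (q : 'I_n) : (at_vertex (arrow_target eps q) w)%:R * f (arrow_source eps q) =
   (at_vertex w.+1 q)%:R * ((eps q.+1)%:R * f (q.+1%:Z + 1)) +
   (at_vertex w q)%:R * ((~~ eps q.+1)%:R * f q.+1%:Z).
  rewrite /arrow_target /arrow_source; case: (eps _) => /=.
    rewrite !mul0r mulr0 addr0 mul1r.
    have -> : at_vertex q.+1 w = at_vertex w.+1 q by rewrite /at_vertex eq_sym.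
    by have -> : q.+2%:Z = q.+1%:Z + 1 by clear; lia.
  rewrite !mul0r mulr0 add0r mul1r; congr (_%:R * _).
  by rewrite /at_vertex (intS q.+1) (intS w) eqz_modDl eq_sym.
rewrite (eq_bigr _ (fun q _ => E2 q)) big_split /=; congr (_ + _).
- rewrite (sum_at_vertex n_gt0 (f := fun k => (eps k)%:R * f (k + 1))).
    by congr (_ * f _); clear; lia.
  by move=> i; rewrite per addrAC fper.
- rewrite (sum_at_vertex n_gt0 (f := fun k => (~~ eps k)%:R * f k)) //.
  by move=> i; rewrite per fper.
Qed.

(** If a row vector is killed by E, its value at a vertex is the sum of its
values at the sources of the arrows into that vertex.  Both signs occur, so the
cycle is not oriented cyclically, and following arrows backwards ends at a
source, where the value is an empty sum. *)
Lemma euler_matrix_unit (R : fieldType) : euler_matrix n eps R \in unitmx.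
Proof.
rewrite -row_free_unit; apply: inj_row_free => x xE0.
pose f (k : int) := x 0 (vertex n_gt0 k).
have fper k : f (k + n%:Z) = f k by rewrite /f vertex_period.
have xf : x = \row_v f v.+1%:Z.
  by apply/rowP => v; rewrite mxE /f vertex_ord.
have rec k : f k = (eps k)%:R * f (k + 1) + (~~ eps (k - 1))%:R * f (k - 1).
  apply/eqP; rewrite -subr_eq0 opprD addrA; apply/eqP.
  pose g i := f i - (eps i)%:R * f (i + 1) - (~~ eps (i - 1))%:R * f (i - 1).
  rewrite -/(g k) -(periodic_vertex n_gt0 (f := g)); last first.
    move=> i; rewrite /g per fper.
    have -> : i + n%:Z + 1 = i + 1 + n%:Z by clear; lia.
    have -> : i + n%:Z - 1 = i - 1 + n%:Z by clear; lia.
    by rewrite !fper per.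
  set w := vertex _ _; have := mul_euler_matrix w fper; rewrite -xf xE0 mxE /g.
  have -> : w.+1%:Z + 1 = w.+2%:Z by clear; lia.
  by have -> : w.+1%:Z - 1 = w%:Z by clear; lia.
have plus_run d k : eps (k - 1) = true -> eps (k + d%:Z) = false -> f k = 0.
  elim: d k => [|d IH] k e1 e2; rewrite rec e1 mul0r addr0.
    by move: e2; rewrite addr0 => ->; rewrite mul0r.
  case ek: (eps k); last by rewrite mul0r.
  rewrite mul1r; apply: IH; first by rewrite addrK.
  by rewrite -e2; congr eps; clear; lia.
have minus_run d k : eps k = false -> eps (k - 1 - d%:Z) = true -> f k = 0.
  elim: d k => [|d IH] k e1 e2; rewrite rec e1 mul0r add0r.
    by move: e2; rewrite subr0 => ->; rewrite mul0r.
  case ek: (eps (k - 1)); first by rewrite mul0r.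
  rewrite mul1r; apply: IH => //.
  by rewrite -e2; congr eps; clear; lia.
have after_plus k : eps (k - 1) = true -> f k = 0.
  move=> e1; have [m [km _ em]] := exists_sign_within false k n_gt0 per surj.
  apply: (plus_run `|m - k|%N) => //.
  by rewrite -em; congr eps; move: km; clear; lia.
have at_minus k : eps k = false -> f k = 0.
  move=> e1; have [m [_ km em]] :=
    exists_sign_within true (k - n%:Z) n_gt0 per surj.
  apply: (minus_run `|(k - 1)%R - m|%N) => //.
  by rewrite -em; congr eps; move: km; clear; lia.
rewrite xf; apply/rowP => v; rewrite !mxE.
move: v.+1%:Z => k; case ek: (eps k); last exact: at_minus.
case ek1: (eps (k - 1)); first exact: after_plus.
by rewrite rec (at_minus _ ek1) (after_plus (k + 1)) ?addrK // !mulr0 addr0.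
Qed.

Lemma euler_form_increments (R : realType) (pi : int -> R) a b :
  periodic_function n pi -> a <= b ->
  euler_form eps (invmx (euler_matrix n eps R)^T *m increments n pi)
    (beta_real R n a b) = pi b - pi a.
Proof.
move=> pper ab; rewrite /euler_form trmx_mul trmx_inv trmxK.
by rewrite mulmxKV ?euler_matrix_unit // pairing_beta.
Qed.

End Euler.

(** * Dimension vectors of submodules of string modules *)

Section Leading.
Variables (K : fieldType) (d : nat).

Definition leading (u : 'rV[K]_d) (r : 'I_d) : Prop :=
  u 0 r != 0 /\ forall s : 'I_d, (r < s)%N -> u 0 s = 0.

Definition leading_index m (W : 'M[K]_(m, d)) (r : 'I_d) : bool :=
  `[< exists2 u : 'rV[K]_d, (u <= W)%MS & leading u r >].

(** The dimension of the vectors of W supported on the first r coordinates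
grows with r exactly when r passes a leading index. *)
Lemma rank_leading_indices m (W : 'M[K]_(m, d)) :
  \rank W = (\sum_(r < d) leading_index W r)%N.
Proof.
pose tail (r : nat) : 'M[K]_d := diag_mx (\row_s (r <= s)%N%:R).
pose L r := (W :&: kermx (tail r))%MS.
have inL r (u : 'rV_d) :
    reflect ((u <= W)%MS /\ forall s : 'I_d, (r <= s)%N -> u 0 s = 0) (u <= L r)%MS.
  rewrite sub_capmx; apply: (iffP andP) => -[uW h]; split=> //.
    move=> s rs; move/sub_kermxP/rowP: h => /(_ s).
    by rewrite mul_mx_diag !mxE rs mulr1.
  apply/sub_kermxP/rowP => s; rewrite mul_mx_diag !mxE.
  by have [/h->|] := leqP r s; rewrite ?mul0r ?mulr0.
have stepL (r : 'I_d) : \rank (L r.+1) = (\rank (L r) + leading_index W r)%N.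
  pose B : 'M[K]_(d, 1) := \col_s (s == r)%:R.
  have mulB (u : 'rV_d) : u *m B = (u 0 r)%:M.
    apply/matrixP => a b; rewrite !ord1 !mxE (bigD1 r) //= mxE eqxx mulr1.
    by rewrite big1 ?addr0 // => s /negbTE sr; rewrite mxE sr mulr0.
  have LB : (L r.+1 :&: kermx B :=: L r)%MS.
    apply/eqmxP/andP; split; apply/rV_subP => u.
      rewrite sub_capmx => /andP[/inL[uW h] /sub_kermxP].
      rewrite mulB => /matrixP/(_ 0 0); rewrite !mxE eqxx mulr1n => ur.
      apply/inL; split=> // s; rewrite leq_eqVlt => /orP[/eqP|/h//].
      by move=> rs; have <- : r = s by exact: val_inj.
    move=> /inL[uW h]; rewrite sub_capmx; apply/andP; split.
      by apply/inL; split=> // s rs; apply: h; exact: ltnW.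
    by apply/sub_kermxP; rewrite mulB h // -scalemx1 scale0r.
  rewrite -(mxrank_mul_ker (L r.+1) B) LB addnC; congr (_ + _)%N.
  case: (boolP (leading_index W r)) => [/asboolP[u uW [ur h]]|/asboolP nolead];
    last first.
    apply/eqP; rewrite mxrank_eq0; apply/eqP/row_matrixP => t.
    rewrite row_mul mulB row0.
    have /inL[tW h] := row_sub t (L r.+1).
    have [->|tr] := eqVneq (row t (L r.+1) 0 r) 0; first by rewrite -scalemx1 scale0r.
    by case: nolead; exists (row t (L r.+1)).
  apply: anti_leq; rewrite rank_leq_col lt0n mxrank_eq0.
  apply/eqP => AB0; move/eqP: ur; apply.
  have /submxP[D uD] : (u <= L r.+1)%MS by apply/inL.
  have : u *m B = 0 by rewrite uD -mulmxA AB0 mulmx0.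
  rewrite mulB => /matrixP/(_ 0 0).
  by rewrite !mxE eqxx mulr1n => ->.
have Lm m' : (m' <= d)%N ->
    \rank (L m') = (\sum_(r < d | (r < m')%N) leading_index W r)%N.
  elim: m' => [_|m' IH md].
    rewrite big_pred0 //; apply/eqP; rewrite mxrank_eq0.
    apply/eqP/row_matrixP => t; have /inL[_ h] := row_sub t (L 0%N).
    by apply/rowP => s; rewrite h // row0 mxE.
  rewrite (stepL (Ordinal md)) IH ?(ltnW md) //.
  rewrite [RHS](bigD1 (Ordinal md)) //= addnC; congr (_ + _)%N.
  by apply: eq_bigl => r; rewrite -val_eqE /= ltnS ltn_neqAle andbC.
have -> : \rank W = \rank (L d).
  apply/eqP; rewrite eqn_leq !mxrankS ?capmxSl //.
  apply/row_subP => t; apply/inL; split; first exact: row_sub.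
  by move=> s ds; have := ltn_ord s; rewrite ltnNge ds.
by rewrite Lm //; apply: eq_bigl => r; rewrite ltn_ord.
Qed.
End Leading.

(** Here S is the indicator function of a set of positions; after summation by
parts only the places where S changes contribute. *)
Lemma sum_by_parts_le0 (R : realType) (d : nat) (S : nat -> bool) (g : nat -> R) :
  g 0%N = 0 -> g d = 0 ->
  (forall r, (r.+1 < d)%N -> g r.+1 * ((S r)%:R - (S r.+1)%:R) <= 0) ->
  \sum_(r < d) (S r)%:R * (g r.+1 - g r) <= 0.
Proof.
case: d => [|d] g0 gd h; first by rewrite big_ord0.
have E m : \sum_(r < m.+1) (S r)%:R * (g r.+1 - g r) =
    (S m)%:R * g m.+1 + \sum_(r < m) g r.+1 * ((S r)%:R - (S r.+1)%:R).
  elim: m => [|m IH]; first by rewrite big_ord1 big_ord0 g0 subr0 addr0.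
  by rewrite big_ord_recr IH big_ord_recr /=; ring.
rewrite E gd mulr0 add0r; apply: sumr_le0 => r _; apply: h.
by rewrite ltnS.
Qed.

(** For pi(i) = pi(j), this says that the horizontal segment from i to j stays
off the walls of [visible], up to touching. *)
Definition sign_split (R : realType) (eps : int -> bool) (i j : int)
    (pi : int -> R) : Prop :=
  pi i = pi j /\
  forall k, i < k -> k < j -> if eps k then pi k <= pi i else pi i <= pi k.

Lemma rank_diagonal (K : fieldType) (d : nat) (P : pred 'I_d) :
  \rank (\matrix_(r, s) ((r == s) && P r)%:R : 'M[K]_d) = (\sum_(r < d) P r)%N.
Proof.
rewrite rank_leading_indices; apply: eq_bigr => r _; congr nat_of_bool.
set A := \matrix_(_, _) _.
have mulA (u : 'rV_d) s : (u *m A) 0 s = u 0 s * (P s)%:R.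
  rewrite mxE (bigD1 s) //= mxE eqxx big1 ?addr0 // => t /negbTE ts.
  by rewrite mxE ts mulr0.
apply/idP/idP => [/asboolP[u /submxP[x ->] [+ _]]|Pr].
  by rewrite mulA; case: (P r) => //; rewrite mulr0 eqxx.
apply/asboolP; exists (delta_mx 0 r *m A); first exact: submxMl.
split=> [|s rs]; rewrite mulA mxE; first by rewrite !eqxx Pr mulr1 oner_neq0.
by rewrite eqxx -(inj_eq val_inj) /= gtn_eqF // mul0r.
Qed.

Section Submodules.
Variables (n : nat) (eps : int -> bool) (K : fieldType) (i j : int).
Hypotheses (n_gt0 : (0 < n)%N) (per : periodic_sign n eps).

Local Notation M a b := (string_module n eps K a b).

Lemma mul_act_vertex (u : 'rV_(act_dim (M i j))) w s :
  (u *m act_vertex (M i j) w) 0 s = u 0 s * (at_vertex (i + 1 + s%:Z) w)%:R.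
Proof.
rewrite mxE (bigD1 s) //= mxE eqxx big1 ?addr0 // => t /negbTE ts.
by rewrite mxE ts mulr0.
Qed.

Lemma at_vertex_sign k (w : 'I_n) : at_vertex k w -> eps w.+1 = eps k.
Proof.
by rewrite (at_vertexE n_gt0) => /eqP ->; exact: periodic_vertex.
Qed.

Lemma vertex_eq_shift k l d :
  vertex n_gt0 k = vertex n_gt0 l -> vertex n_gt0 (k + d) = vertex n_gt0 (l + d).
Proof.
have per_d x : vertex n_gt0 (x + n%:Z + d) = vertex n_gt0 (x + d).
  by rewrite addrAC vertex_period.
move=> kl; rewrite -(periodic_vertex n_gt0 k per_d) kl.
exact: (periodic_vertex n_gt0 l per_d).
Qed.

Lemma act_arrowE q t s : act_arrow (M i j) q t s =
  (if eps q.+1 then (t == s.+1 :> nat) && at_vertex (i + 1 + s%:Z) q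
   else (s == t.+1 :> nat) && at_vertex (i + 1 + t%:Z) q)%:R.
Proof.
rewrite mxE; congr (nat_of_bool _)%:R.
case: (boolP (at_vertex (i + 1 + s%:Z) q)) => [/at_vertex_sign <-|_];
case: (boolP (at_vertex (i + 1 + t%:Z) q)) => [/at_vertex_sign <-|_];
case: (eps q.+1); rewrite ?andbF ?andbT ?orbF //=.
Qed.

Variable U : 'M[K]_(act_dim (M i j)).
Hypothesis sub_U : is_submodule U.

(** The positions of the leading terms of the homogeneous vectors of U.  An
arrow moves all basis vectors by the same step, so it carries a leading term
to a leading term unless it kills it; the basis vectors at these positions
therefore span a submodule, with the dimension vector of U. *)
Definition lead (r : nat) : bool :=
  `[< exists (u : 'rV_(act_dim (M i j))) (r' : 'I_(act_dim (M i j))),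
      [/\ (u <= U)%MS, u = u *m act_vertex (M i j) (vertex n_gt0 (i + 1 + r%:Z)),
          r' = r :> nat & leading u r'] >].

Lemma homogeneousE (u : 'rV_(act_dim (M i j))) w s :
  u = u *m act_vertex (M i j) w -> u 0 s != 0 ->
  vertex n_gt0 (i + 1 + s%:Z) = w.
Proof.
move=> /rowP/(_ s); rewrite mul_act_vertex => E us.
apply/esym/eqP; rewrite -at_vertexE; apply: contraNT us => /negbTE h.
by rewrite E h mulr0.
Qed.

Lemma homogeneousP (u : 'rV_(act_dim (M i j))) w :
  (forall s, u 0 s != 0 -> vertex n_gt0 (i + 1 + s%:Z) = w) ->
  u = u *m act_vertex (M i j) w.
Proof.
move=> h; apply/rowP => s; rewrite mul_act_vertex.
have [->|/h <-] := eqVneq (u 0 s) 0; first by rewrite mul0r.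
by rewrite at_vertexE eqxx mulr1.
Qed.

Lemma lead_succ r : (r.+1 < act_dim (M i j))%N -> eps (i + 1 + r%:Z) = false ->
  lead r -> lead r.+1.
Proof.
move=> rD er /asboolP[u [r' [uU hu r'E [ur0 u0]]]].
set q := vertex n_gt0 _ in hu.
have eq_ : eps q.+1 = false by rewrite -er; exact: periodic_vertex.
pose u' := u *m act_arrow (M i j) q.
have u'S (s t : 'I_(act_dim (M i j))) : s = t.+1 :> nat -> u' 0 s = u 0 t.
  move=> st; rewrite mxE (bigD1 t) //= act_arrowE eq_ st eqxx /= big1 ?addr0.
    have [->|] := eqVneq (u 0 t) 0; first by rewrite mul0r.
    by move=> /(homogeneousE hu) tq; rewrite (at_vertexE n_gt0) tq eqxx mulr1.
  move=> x xt; rewrite act_arrowE eq_ st eqSS eq_sym.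
  by rewrite (inj_eq val_inj) (negbTE xt) mulr0.
have u'0 (s : 'I_(act_dim (M i j))) : s = 0%N :> nat -> u' 0 s = 0.
  by move=> s0; rewrite mxE big1 // => x _; rewrite act_arrowE eq_ s0 mulr0.
have cases (s : 'I_(act_dim (M i j))) : u' 0 s != 0 ->
    exists2 t : 'I_(act_dim (M i j)), s = t.+1 :> nat & u' 0 s = u 0 t.
  case: s => [[|s] sD] us.
    by case/eqP: us; exact: u'0.
  by exists (Ordinal (ltnW sD)) => //; exact: u'S.
apply/asboolP; exists u', (Ordinal rD); split=> //.
- exact: submx_trans (submxMr _ uU) (sub_U q).2.
- apply: homogeneousP => s /[dup] us /cases[t st ut].
  have ut0 : u 0 t != 0 by rewrite -ut.
  have := vertex_eq_shift 1 (homogeneousE hu ut0); rewrite st => E.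
  have -> : i + 1 + t.+1%:Z = i + 1 + t%:Z + 1 by clear; lia.
  have -> : i + 1 + r.+1%:Z = i + 1 + r%:Z + 1 by clear; lia.
  exact: E.
- split; first by rewrite (u'S _ r') //= r'E.
  move=> s; rewrite /= => rs; apply/eqP; apply: contraT => us.
  have [t st ut] := cases s us; move: us; rewrite ut u0 ?eqxx //.
  by rewrite r'E -ltnS -st.
Qed.

Lemma lead_pred r : (r.+1 < act_dim (M i j))%N -> eps (i + 1 + r%:Z) = true ->
  lead r.+1 -> lead r.
Proof.
move=> rD er /asboolP[u [r' [uU hu r'E [ur0 u0]]]].
set w := vertex n_gt0 _ in hu; set q := vertex n_gt0 (i + 1 + r%:Z).
have eq_ : eps q.+1 = true by rewrite -er; exact: periodic_vertex.
have back (s t : 'I_(act_dim (M i j))) : t = s.+1 :> nat -> u 0 t != 0 ->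
    vertex n_gt0 (i + 1 + s%:Z) = q.
  move=> ts /(homogeneousE hu) /(vertex_eq_shift (-1)); rewrite ts.
  have -> : i + 1 + s.+1%:Z - 1 = i + 1 + s%:Z by clear; lia.
  by have -> : i + 1 + r.+1%:Z - 1 = i + 1 + r%:Z by clear; lia.
pose u' := u *m act_arrow (M i j) q.
have u'S (s t : 'I_(act_dim (M i j))) : t = s.+1 :> nat -> u' 0 s = u 0 t.
  move=> ts; rewrite mxE (bigD1 t) //= act_arrowE eq_ ts eqxx /= big1 ?addr0.
    have [->|] := eqVneq (u 0 t) 0; first by rewrite mul0r.
    by move=> /(back _ _ ts) sq; rewrite (at_vertexE n_gt0) sq eqxx mulr1.
  move=> x xt; rewrite act_arrowE eq_ -ts.
  by rewrite (inj_eq val_inj) (negbTE xt) mulr0.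
have cases (s : 'I_(act_dim (M i j))) : u' 0 s != 0 ->
    exists2 t : 'I_(act_dim (M i j)), t = s.+1 :> nat & u' 0 s = u 0 t.
  have [sD|Ds] := ltnP s.+1 (act_dim (M i j)).
    by move=> _; exists (Ordinal sD) => //; exact: u'S.
  rewrite mxE big1 ?eqxx // => x _; rewrite act_arrowE eq_.
  by rewrite ltn_eqF ?mulr0 // (leq_trans (ltn_ord x)).
apply/asboolP; exists u', (Ordinal (ltnW rD)); split=> //.
- exact: submx_trans (submxMr _ uU) (sub_U q).2.
- apply: homogeneousP => s /[dup] us /cases[t ts ut].
  by apply: (back s t); rewrite // -ut.
- split; first by rewrite (u'S _ r') //= r'E.
  move=> s; rewrite /= => rs; apply/eqP; apply: contraT => us.
  have [t ts ut] := cases s us; move: us; rewrite ut u0 ?eqxx //.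
  by rewrite r'E ts.
Qed.

(** The space of vectors of U at a vertex has the positions at that vertex as
its leading indices. *)
Lemma leading_index_vertex w (r : 'I_(act_dim (M i j))) :
  leading_index (U *m act_vertex (M i j) w) r =
  at_vertex (i + 1 + r%:Z) w && lead r.
Proof.
rewrite (at_vertexE n_gt0); apply/idP/idP => [/asboolP[u uUw [ur u0]]|].
  have hu : u = u *m act_vertex (M i j) w.
    apply: homogeneousP => s; have /submxP[x ->] := uUw.
    rewrite mulmxA mul_act_vertex => us; apply/esym/eqP; rewrite -at_vertexE.
    by apply: contraNT us => /negbTE ->; rewrite mulr0.
  have rw := homogeneousE hu ur; rewrite rw eqxx /=.
  apply/asboolP; exists u, r; rewrite rw; split=> //.
  exact: submx_trans uUw (sub_U w).1.
move=> /andP[/eqP -> /asboolP[u [r' [uU hu r'E lu]]]].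
apply/asboolP; exists u; last by rewrite -(val_inj r'E).
by rewrite {1}hu submxMr.
Qed.
End Submodules.

Lemma iso_submodule_rank n (K : fieldType) (M N : path_action n K)
    (U : 'M[K]_(act_dim N)) (f : 'M[K]_(act_dim M, act_dim N)) w :
  is_module_hom f -> row_free f -> (f :=: U)%MS ->
  \rank (U *m act_vertex N w) = \rank (act_vertex M w).
Proof.
move=> hom free fU.
by rewrite -(eqmxMr (act_vertex N w) fU) -(hom w).1 mxrankMfree.
Qed.

(** With S the set of leading positions of a submodule isomorphic to M_ab,
pi(b) - pi(a) is the sum of the increments of pi over S.  Where S changes, the
arrow there goes into S, and the sign that fixes its orientation also tells
whether pi is above or below pi(i). *)
Lemma subroot_le (R : realType) (K : fieldType) n eps (pi : int -> R) a b i j :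
  (0 < n)%N -> periodic_sign n eps -> periodic_function n pi ->
  i < j -> sign_split eps i j pi -> a < b -> subroot n eps K a b i j ->
  pi b <= pi a.
Proof.
move=> n_gt0 per pper ij [pij split] ab [U [sub_U [f [hom free fU]]]].
pose D := `|j - i|%N.
rewrite -subr_le0 -(@pairing_beta n n_gt0 R) //; last exact: ltW.
have -> : ((increments n pi)^T *m beta_real R n a b) 0 0 =
    \sum_(r < D) (lead n_gt0 U r)%:R *
      ((pi (i + r.+1%:Z) - pi i) - (pi (i + r%:Z) - pi i)).
  have betaE w : beta_real R n a b w 0 = \sum_(r < D)
      (at_vertex (i + 1 + r%:Z) w)%:R * (lead n_gt0 U r)%:R.
    rewrite mxE summxE; under eq_bigr do rewrite mxE.
    rewrite -natr_sum rmorph_nat -(@rank_diagonal K).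
    rewrite -/(act_vertex (string_module n eps K a b) w).
    rewrite -(iso_submodule_rank w hom free fU) rank_leading_indices natr_sum.
    by apply: eq_bigr => r _; rewrite leading_index_vertex // -mulnb natrM.
  pose h k := pi k - pi (k - 1).
  have hper k : h (k + n%:Z) = h k.
    by rewrite /h addrAC; have := pper k (k - 1); lra.
  have termE w : (increments n pi)^T 0 w * beta_real R n a b w 0 =
      \sum_(r < D) (lead n_gt0 U r)%:R *
        ((at_vertex (i + 1 + r%:Z) w)%:R * h w.+1%:Z).
    rewrite betaE mulr_sumr; apply: eq_bigr => r _; rewrite !mxE /h.
    have -> : w.+1%:Z - 1 = w%:Z by clear; lia.
    by rewrite [RHS]mulrCA [RHS]mulrA mulrC.
  rewrite mxE (eq_bigr _ (fun w _ => termE w)).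
  rewrite exchange_big /=; apply: eq_bigr => r _.
  rewrite -mulr_sumr sum_at_vertex // /h; congr (_ * _).
  rewrite opprB addrA subrK; congr (pi _ - pi _); clear; lia.
apply: (@sum_by_parts_le0 _ _ (lead n_gt0 U) (fun r => pi (i + r%:Z) - pi i)).
- by rewrite addr0 subrr.
- rewrite pij; have -> : i + D%:Z = j by rewrite /D; move: ij; clear; lia.
  by rewrite subrr.
move=> r rD.
have := split (i + r.+1%:Z); have -> : i < i + r.+1%:Z by clear; lia.
have -> : i + r.+1%:Z < j by move: rD ij; rewrite /D; clear; lia.
move=> /(_ isT isT).
have kE : i + 1 + r%:Z = i + r.+1%:Z by clear; lia.
case: ifP => ek.
  have := @lead_pred _ _ _ _ _ n_gt0 per _ sub_U _ rD; rewrite kE ek => /(_ erefl).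
  case: (lead _ _ r.+1) => [-> //|_]; first by rewrite subrr mulr0.
  by move=> h; rewrite subr0 mulr_le0_ge0 ?subr_le0 ?ler0n.
have := @lead_succ _ _ _ _ _ n_gt0 per _ sub_U _ rD; rewrite kE ek => /(_ erefl).
case: (lead _ _ r) => [-> //|_]; first by rewrite subrr mulr0.
by move=> h; rewrite sub0r mulr_ge0_le0 ?subr_ge0 // oppr_le0 ler0n.
Qed.

(** The end conditions say that the arrows at the ends of the interval point
into it, so that the span of its basis vectors is a submodule. *)
Lemma subroot_interval (K : fieldType) n eps a b i j : (0 < n)%N ->
  periodic_sign n eps -> i <= a -> a < b -> b <= j ->
  (a = i \/ eps a = false) -> (b = j \/ eps b = true) ->
  subroot n eps K a b i j.
Proof.
move=> n_gt0 per ia ab bj ea eb.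
pose M := string_module n eps K a b; pose N := string_module n eps K i j.
pose off := `|a - i|%N.
have gP (r : 'I_(act_dim M)) : (off + r < act_dim N)%N.
  case: r => r /=; rewrite /off; move: ia ab bj; clear; lia.
pose g r : 'I_(act_dim N) := Ordinal (gP r).
have g_inj : injective g by move=> x y [] /addnI; exact: val_inj.
pose f : 'M[K]_(act_dim M, act_dim N) := \matrix_(r, s) (s == g r)%:R.
have fmul m (A : 'M[K]_(act_dim N, m)) r s : (f *m A) r s = A (g r) s.
  rewrite mxE (bigD1 (g r)) //= mxE eqxx mul1r big1 ?addr0 // => t /negbTE tr.
  by rewrite mxE tr mul0r.
have mulf m (A : 'M[K]_(m, act_dim M)) r t : (A *m f) r (g t) = A r t.
  rewrite mxE (bigD1 t) //= mxE eqxx mulr1 big1 ?addr0 // => x xt.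
  by rewrite mxE (inj_eq g_inj) eq_sym (negbTE xt) mulr0.
have mulf0 m (A : 'M[K]_(m, act_dim M)) r s : (forall t, s != g t) ->
    (A *m f) r s = 0.
  by move=> st; rewrite mxE big1 // => t _; rewrite mxE (negbTE (st t)) mulr0.
have inim (s : 'I_(act_dim N)) : (off <= s < off + act_dim M)%N ->
    exists t, s = g t.
  move=> /andP[os so]; have sM : (s - off < act_dim M)%N by rewrite ltn_subLR.
  by exists (Ordinal sM); apply: val_inj; rewrite /= subnKC.
have pos (r : 'I_(act_dim M)) : i + 1 + (g r)%:Z = a + 1 + r%:Z.
  by rewrite /= /off; move: ia; clear; lia.
have hom : is_module_hom f.
  move=> q; split; apply/matrixP => r s; rewrite fmul.
    have [[t ->]|nog] := pselect (exists t, s = g t).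
      by rewrite mulf !mxE (inj_eq g_inj) pos.
    rewrite mulf0; last by move=> t; apply/eqP => st; apply: nog; exists t.
    by rewrite mxE; case: eqVneq => // gs; case: nog; exists r.
  rewrite (act_arrowE n_gt0 per).
  have [[t ->]|nog] := pselect (exists t, s = g t).
    rewrite mulf (act_arrowE n_gt0 per) !pos /= -addnS eqn_add2l.
    by rewrite -addnS eqn_add2l.
  rewrite mulf0; last by move=> t; apply/eqP => st; apply: nog; exists t.
  have out : ~~ (off <= s < off + act_dim M)%N.
    by apply/negP => /inim [t st]; apply: nog; exists t.
  case eq_: (eps q.+1).
    case: (eqVneq (g r : nat) s.+1) => //= rs.
    have sa : i + 1 + s%:Z = a /\ a != i.
      have := ltn_ord r; move: rs out ia; rewrite /M /= /off; clear; lia.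
    case: sa => sa ai; case: ea => [E|ea]; first by rewrite E eqxx in ai.
    rewrite sa; case: (boolP (at_vertex a q)) => // /(at_vertex_sign n_gt0 per).
    by rewrite eq_ ea.
  case: (eqVneq (s : nat) (g r).+1) => //= rs.
  have sb : i + 1 + (off + r)%N%:Z = b /\ b != j.
    have := ltn_ord s; have := ltn_ord r; move: rs out ia bj ab.
    rewrite /M /N /= /off; clear; lia.
  case: sb => sb bj'; case: eb => [E|eb]; first by rewrite E eqxx in bj'.
  rewrite sb.
  case: (boolP (at_vertex b q)) => // /(at_vertex_sign n_gt0 per).
  by rewrite eq_ eb.
exists <<f>>%MS; split.
  move=> q; have stab (A : 'M[K]_(act_dim N)) (B : 'M[K]_(act_dim M)) :
      B *m f = f *m A -> stablemx <<f>>%MS A.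
    move=> BA; apply: submx_trans (_ : f *m A <= _)%MS.
      by rewrite submxMr ?genmxE.
    by rewrite -BA genmxE submxMl.
  by split; [exact: stab (hom q).1 | exact: stab (hom q).2].
exists f; split=> //; last by apply/eqmx_sym/genmxE.
apply: inj_row_free => v vf0; apply/rowP => r.
by rewrite -mulf vf0 !mxE.
Qed.

(** * The real support in terms of periodic functions *)

Lemma periodic_function_shift (R : realType) n (pi : int -> R) (s k : int) :
  periodic_function n pi ->
  pi (k + s * n%:Z) = pi k + s%:~R * (pi n%:Z - pi 0).
Proof.
move=> per.
have one x : pi (x + n%:Z) = pi x + (pi n%:Z - pi 0).
  by have := per x 0; rewrite add0r; lra.
elim/int_ind: s => [|s IH|s IH]; first by rewrite !mul0r !addr0.
- have -> : k + s.+1%:Z * n%:Z = k + s%:Z * n%:Z + n%:Z by clear; lia.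
  by rewrite one IH -addn1 PoszD intrD; ring.
- have E : k + - s%:Z * n%:Z = k + - s.+1%:Z * n%:Z + n%:Z by clear; lia.
  move: IH; rewrite E one => IH.
  have -> : (- s.+1%:Z)%:~R = (- s%:Z)%:~R - 1 :> R.
    by rewrite -addn1 PoszD opprD intrD.
  by rewrite mulrBl mul1r; move: IH; lra.
Qed.

Lemma residue_above n (i k : int) : (0 < n)%N ->
  exists s r, [/\ k = i + r + s * n%:Z, 0 <= r & r < n%:Z].
Proof.
move=> n_gt0; exists ((k - i) %/ n%:Z)%Z, ((k - i) %% n%:Z)%Z; split.
- rewrite -addrA [X in i + X]addrC -divz_eq; clear; lia.
- by rewrite modz_ge0 // period_neq0.
- by rewrite ltz_pmod.
Qed.

Lemma schur_not_translate n eps i j s : periodic_sign n eps ->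
  real_schur_pair n eps i j -> j <> i + s * n%:Z.
Proof.
move=> per [ij schur] jE.
case: schur => [|[_ jn]]; first by rewrite jE periodic_sign_shift ?eqxx.
have n0 : 0 < n%:Z by move: ij jn; clear; lia.
have : s * n%:Z < 1 * n%:Z by rewrite mul1r; move: jn; rewrite jE ltrD2l.
have : 0 * n%:Z < s * n%:Z by rewrite mul0r; move: ij; rewrite jE ltrDl.
by rewrite !ltr_pM2r //; clear; lia.
Qed.

Section Support.
Variables (R : realType) (K : fieldType) (n : nat) (eps : int -> bool).
Hypotheses (n_ge2 : (2 <= n)%N) (per : periodic_sign n eps).
Hypothesis surj : surjective_sign eps.
Variables (i j : int) (pi : int -> R).
Hypotheses (schur : real_schur_pair n eps i j) (pper : periodic_function n pi).

Let n_gt0 : (0 < n)%N := ltnW n_ge2.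
Let v := invmx (euler_matrix n eps R)^T *m increments n pi.

Lemma sign_split_support : sign_split eps i j pi -> real_support R n eps K i j v.
Proof.
have [ij _] := schur; move=> split; split=> [|a b [ab _] sub].
  by rewrite euler_form_increments ?(ltW ij) // split.1 subrr.
rewrite euler_form_increments ?(ltW ab) // subr_le0.
exact: subroot_le n_gt0 per pper ij split ab sub.
Qed.

(** For k of sign + the interval (i, k] is a submodule, and for k of sign -
the interval (k, j] is one.  It is a real Schur root unless its ends have the
same sign and its length is at least n.  In that case i has sign +, j has sign -,
and the slope c of pi is nonpositive, so that k may be moved by multiples of n
to where the interval is short. *)
Lemma support_sign_split : real_support R n eps K i j v -> sign_split eps i j pi.
Proof.
have [ij ij_schur] := schur; move=> [vij vsub].
have pij : pi j = pi i.
  apply/eqP.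
  by rewrite -subr_eq0 -(euler_form_increments n_ge2 per surj pper (ltW ij)) vij.
have drop a b : i <= a -> a < b -> b <= j -> (a = i \/ eps a = false) ->
    (b = j \/ eps b = true) -> eps a != eps b \/ b < a + n%:Z -> pi b <= pi a.
  move=> ia ab bj ea eb rs.
  rewrite -subr_le0 -(euler_form_increments n_ge2 per surj pper (ltW ab)).
  apply: vsub.
    split=> //; case: (eqVneq (eps a) (eps b)) => [e|]; last by left.
    by right; split=> //; case: rs => //; rewrite e eqxx.
  exact: subroot_interval.
set c := pi n%:Z - pi 0.
have shift s k : pi (k + s * n%:Z) = pi k + s%:~R * c.
  exact: periodic_function_shift.
have esh s k : eps (k + s * n%:Z) = eps k by exact: periodic_sign_shift.
have c_le0 : i + n%:Z < j -> [/\ eps i = true, eps j = false & c <= 0] \/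
    (eps i = false /\ eps j = true).
  move=> jn.
  have eij : eps i != eps j by case: ij_schur => // -[_]; rewrite ltNge (ltW jn).
  case ei: (eps i) eij => //; case ej: (eps j) => // _; last by right.
  left; split=> //.
  (* Compare j - n, of sign -, with the last translate i + t n of i before j. *)
  have [t [r [jE r0 rn]]] := residue_above i j n_gt0.
  have r_neq0 : r != 0.
    apply/eqP => r0'; move: ej; rewrite jE r0' addr0 esh ei; done.
  have t_gt0 : 0 < t.
    have : 0 < t * n%:Z by move: jn rn; rewrite jE; clear; lia.
    by rewrite pmulr_lgt0.
  have bE : i + t * n%:Z = j - r by rewrite jE; clear; lia.
  have : pi (i + t * n%:Z) <= pi (j + (-1) * n%:Z).
    apply: drop; rewrite ?esh ?ei ?ej; [| | | by right | by right | by left].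
    - by move: jn; clear; lia.
    - by rewrite bE; move: rn; clear; lia.
    - by rewrite bE; move: r0; clear; lia.
  rewrite !shift pij lerD2l => tc; rewrite leNgt; apply/negP => c_gt0.
  have : 0 < t%:~R * c by rewrite mulr_gt0 ?ltr0z.
  by move: tc; rewrite mulN1r; move: c_gt0; lra.
split=> // k ik kj; case ek: (eps k).
- have [kn|kn] := ltP k (i + n%:Z).
    by apply: drop => //; [exact: ltW | left | right | right].
  case ei: (eps i); last first.
    by apply: drop; rewrite ?ei ?ek //; [exact: ltW | left | right | left].
  have [[_ _ c0]|[]] := c_le0 (le_lt_trans kn kj); last by rewrite ei.
  have [s [r [kE r0 rn]]] := residue_above i k n_gt0.
  have s_ge0 : 0 <= s.
    have : 0 <= s * n%:Z by move: kn rn; rewrite kE; clear; lia.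
    by rewrite pmulr_lge0.
  rewrite kE shift; apply: le_trans (_ : pi (i + r) <= _).
    by rewrite gerDl mulr_ge0_le0 ?ler0z.
  have [->|r_neq0] := eqVneq r 0; first by rewrite addr0.
  have rk : i + r <= k.
    by rewrite kE lerDl mulr_ge0.
  apply: drop; [by [] | | by apply: ltW; exact: le_lt_trans rk kj | by left | |].
  + by move: r0 r_neq0; clear; lia.
  + by right; rewrite -ek kE esh.
  + by right; rewrite ltrD2l.
- rewrite -pij; have [jn|jn] := ltP j (k + n%:Z).
    by apply: drop => //; [exact: ltW | right | left | right].
  case ej: (eps j).
    by apply: drop; rewrite ?ej ?ek //; [exact: ltW | right | left | left].
  have [|[_ _ c0]|[_]] := c_le0 _; last by rewrite ej.
    by move: jn ik; clear; lia.
  have [s [r [kE r0 rn]]] := residue_above k j n_gt0.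
  have s_ge0 : 0 <= s.
    have : 0 <= s * n%:Z by move: jn rn; rewrite kE; clear; lia.
    by rewrite pmulr_lge0.
  have kE' : k + s * n%:Z = j - r by rewrite kE; clear; lia.
  apply: le_trans (_ : pi (k + s * n%:Z) <= _); last first.
    by rewrite shift gerDl mulr_ge0_le0 ?ler0z.
  rewrite kE'.
  have [->|r_neq0] := eqVneq r 0; first by rewrite subr0.
  have rk : k <= j - r by rewrite -kE' lerDl mulr_ge0.
  apply: drop; [by apply: ltW; exact: lt_le_trans ik rk | | by [] | right | by left |].
  + by move: r0 r_neq0; clear; lia.
  + by rewrite -kE' esh.
  + by right; move: rn; clear; lia.
Qed.
End Support.

(** * Approximation by integer heights *)

Lemma residue_unique n (r r' s s' : int) : 0 <= r -> r < n%:Z -> 0 <= r' ->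
  r' < n%:Z -> r + s * n%:Z = r' + s' * n%:Z -> r = r' /\ s = s'.
Proof.
move=> r0 rn r0' rn' E.
have n_neq0 : n%:Z != 0 by move: r0 rn; clear; lia.
have small x : 0 <= x -> x < n%:Z -> (x %/ n%:Z)%Z = 0.
  by move=> x0 xn; rewrite divz_small // x0 gtz0_abs // (le_lt_trans x0 xn).
have : s = s'.
  have /(congr1 (fun x => (x %/ n%:Z)%Z)) := E.
  by rewrite ![_ + _ * n%:Z]addrC !divzMDl // !small // !addr0.
by move=> ss; move: E; rewrite ss => /addIr.
Qed.

Lemma floor_bounds (R : realType) (x : R) :
  (Num.floor x)%:~R <= x /\ x < (Num.floor x)%:~R + 1.
Proof. by have /andP[? ?] := floor_itv x; rewrite -intrD1. Qed.

Section Approximation.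
Variables (R : realType) (n : nat) (eps : int -> bool) (i j : int).
Variable pi : int -> R.
Hypotheses (n_gt0 : (0 < n)%N) (per : periodic_sign n eps).
Hypotheses (schur : real_schur_pair n eps i j) (pper : periodic_function n pi).
Hypothesis split : sign_split eps i j pi.

(** The values of pi / eta are rounded, residue by residue, to integers, which
are then multiplied by n and shifted by the residue; this makes the values of
different residue classes distinct modulo n.  The class of j is tied to that of
i instead, by A(j) = A(i).  Moving the other classes by the constant L, up or
down according to their sign, outweighs all rounding errors and makes the
position relative to the edge strict, and the slope n y is kept nonzero with
the right sign. *)
Lemma integer_approximation (e : R) : 0 < e ->
  exists (A : int -> int) (C : int) (delta : R),
  [/\ 0 < delta /\ (forall k, A (k + n%:Z) = A k + C),
      A i = A j,
      forall p q, A p = A q -> p = q \/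
        exists s, (p = i + s * n%:Z /\ q = j + s * n%:Z) \/
                  (p = j + s * n%:Z /\ q = i + s * n%:Z),
      forall k, i < k -> k < j -> if eps k then A k < A i else A i < A k &
      forall k, 0 <= k -> k <= n%:Z -> `|delta * (A k)%:~R - pi k| < e].
Proof.
move=> e0; have [ij ij_schur] := schur; have [pij spl] := split.
have [t [rj [jE rj0 rjn]]] := residue_above i j n_gt0.
have shift s k : pi (k + s * n%:Z) = pi k + s%:~R * (pi n%:Z - pi 0).
  exact: periodic_function_shift.
set c := pi n%:Z - pi 0 in shift.
have esh s k : eps (k + s * n%:Z) = eps k by exact: periodic_sign_shift.
have t0 : 0 <= t.
  have : - n%:Z < t * n%:Z by move: ij rjn; rewrite jE; clear; lia.
  by rewrite -mulN1r ltr_pM2r.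
have rj_neq0 : rj != 0.
  apply/eqP => r0; apply: (schur_not_translate per schur (s := t)).
  by rewrite jE r0 addr0.
(* The rounding error is at most B times the step eta. *)
pose B : R := t%:~R * 2 + 6 + (n%:R * 4 + `|i|%:~R * 2).
have B0 : 0 < B.
  have : 0 <= t%:~R :> R by rewrite ler0z.
  have : 0 <= `|i|%:~R :> R by rewrite ler0z.
  have : 0 <= n%:R :> R by [].
  by rewrite /B; lra.
pose eta := e / B.
have eta0 : 0 < eta by rewrite divr_gt0.
pose c' := c / eta; pose u r := pi (i + r) / eta.
pose y : int := if (c < 0) || ((c == 0) && eps i) then Num.floor c' - 1
                else Num.floor c' + 1.
have y_neq0 : y != 0.
  rewrite /y; case: ifP => [/orP[c0|/andP[/eqP c0 _]]|/negbT].
  - have : c' < 0 by rewrite /c' pmulr_llt0 // invr_gt0.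
    by rewrite -floor_lt0; clear; lia.
  - by rewrite /c' c0 mul0r floor0.
  - rewrite negb_or -leNgt => /andP[c0 _].
    have : 0 <= c' by rewrite /c' pmulr_lge0 // invr_gt0.
    by rewrite -floor_ge0; move: (Num.floor c') => f; clear; lia.
have y_bounds : c' - 2 <= y%:~R /\ y%:~R <= c' + 1.
  have [lo hi] := floor_bounds c'; rewrite /y; case: ifP => _.
    by rewrite intrB mulr1z; split; lra.
  by rewrite intrD mulr1z; split; lra.
(* If i + n lies between the ends, its position fixes the sign of c. *)
have y_sign : i + n%:Z < j -> if eps i then y <= -1 else 1 <= y.
  move=> jn; have := spl (i + n%:Z); rewrite per ltrDl ltz_nat n_gt0 jn.
  move=> /(_ isT isT); have := shift 1 i; rewrite mul1r mul1r => ->.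
  rewrite /y; case: (eps i); rewrite ?andbT ?andbF ?orbF => c0.
    have {}c0 : c <= 0 by move: c0; lra.
    rewrite orbC -le_eqVlt c0.
    have : c' <= 0 by rewrite /c' pmulr_lle0 // invr_gt0.
    have [+ _] := floor_bounds c' => /le_trans h /h.
    by rewrite lerz0; clear; lia.
  have {}c0 : 0 <= c by move: c0; lra.
  rewrite ltNge c0 /=.
  have : 0 <= c' by rewrite /c' pmulr_lge0 // invr_gt0.
  by rewrite -floor_ge0; move: (Num.floor c') => f; clear; lia.
(* Residues are counted from i; z is the rounded value and l the label modulo n
that keeps the classes apart. *)
pose L : int := 2 * t + 3.
pose z (r : int) : int := if r == 0 then Num.floor (u 0)
  else if r == rj then Num.floor (u 0) - t * y
  else if eps (i + r) then Num.floor (u r) - L else Num.floor (u r) + L.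
pose l (r : int) : int := if r == rj then 0 else r.
pose q (k : int) := ((k - i) %/ n%:Z)%Z; pose m (k : int) := ((k - i) %% n%:Z)%Z.
pose A k := n%:Z * (z (m k) + q k * y) + l (m k).
have AE r s : 0 <= r -> r < n%:Z ->
    A (i + r + s * n%:Z) = n%:Z * (z r + s * y) + l r.
  move=> r0 rn; rewrite /A /q /m.
  have -> : i + r + s * n%:Z - i = s * n%:Z + r by clear; lia.
  have n_neq0 := period_neq0 n_gt0.
  have rs : 0 <= r < n%:Z by rewrite r0.
  by rewrite divzMDl // modzMDl divz_small ?modz_small ?addr0 // gtz0_abs.
have A0 s : A (i + s * n%:Z) = n%:Z * (z 0 + s * y).
  have := AE 0 s (lexx 0); rewrite [i + 0]addr0 /l eq_sym (negbTE rj_neq0) addr0.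
  by apply; rewrite ltz_nat.
have Aj s : A (j + s * n%:Z) = n%:Z * (z 0 + s * y).
  rewrite jE -addrA -mulrDl AE // /l eqxx addr0 /z (negbTE rj_neq0) !eqxx.
  by congr (_ * _); clear; ring.
have zgen r : r != 0 -> r != rj ->
    z r = if eps (i + r) then Num.floor (u r) - L else Num.floor (u r) + L.
  by move=> /negbTE r0 /negbTE rr; rewrite /z r0 rr.
have l_bounds r : 0 <= r -> r < n%:Z -> 0 <= l r /\ l r < n%:Z.
  by move=> r0 rn; rewrite /l; case: ifP; rewrite ?ltz_nat.
have uE r s : pi (i + r + s * n%:Z) = eta * (u r + s%:~R * c').
  have eta_neq0 : eta != 0 by rewrite gt_eqF.
  by rewrite shift /u /c'; field.
have u0E : pi i = eta * u 0 by have := uE 0 0; rewrite !mul0r !addr0.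
have ujE : u 0 = u rj + t%:~R * c'.
  have eta_neq0 : eta != 0 by rewrite gt_eqF.
  by apply: (mulfI eta_neq0); rewrite -u0E pij jE uE.
exists A, (n%:Z * y), (eta / n%:R); split.
- split=> [|k]; first by rewrite divr_gt0 // ltr0n.
  have [s [r [-> r0 rn]]] := residue_above i k n_gt0.
  have -> : i + r + s * n%:Z + n%:Z = i + r + (s + 1) * n%:Z by clear; lia.
  by rewrite !AE //; clear; ring.
- by have := A0 0; have := Aj 0; rewrite mul0r !addr0 => -> ->.
- move=> a b; have [s [r [-> r0 rn]]] := residue_above i a n_gt0.
  have [s' [r' [-> r0' rn']]] := residue_above i b n_gt0.
  rewrite !AE // => E.
  have [lr zr] : l r = l r' /\ z r + s * y = z r' + s' * y.
    have [? ?] := l_bounds _ r0 rn; have [? ?] := l_bounds _ r0' rn'.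
    apply: (@residue_unique n) => //.
    by rewrite addrC mulrC E mulrC addrC.
  have [rr|rr] := eqVneq r r'.
    left; congr (_ + _ + _ * _) => //.
    by move: zr; rewrite rr => /addrI /(mulIf y_neq0).
  right; move: lr zr; rewrite /l; case: (eqVneq r rj) => [rE|rN];
    case: (eqVneq r' rj) => [rE'|rN'] lr zr.
  + by rewrite rE rE' eqxx in rr.
  + exists s'; right.
    have s'E : s' = s - t.
      apply/(mulIf y_neq0); move: zr; rewrite -lr rE /z (negbTE rj_neq0) !eqxx.
      by rewrite mulrBl; clear; lia.
    by rewrite -lr rE s'E jE; split; clear; lia.
  + exists s; left.
    have sE : s = s' - t.
      apply/(mulIf y_neq0); move: zr; rewrite lr rE' /z (negbTE rj_neq0) !eqxx.
      by rewrite mulrBl; clear; lia.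
    by rewrite lr rE' sE jE; split; clear; lia.
  + by rewrite lr eqxx in rr.
- move=> k; have [s [r [-> r0 rn]]] := residue_above i k n_gt0 => ik kj.
  have := spl _ ik kj.
  have s0 : 0 <= s.
    have : - n%:Z < s * n%:Z by move: ik rn; clear; lia.
    by rewrite -mulN1r ltr_pM2r.
  have Ai : A i = n%:Z * z 0 by have := A0 0; rewrite !mul0r !addr0.
  have n0 : 0 < n%:Z by rewrite ltz_nat.
  have [r_0|r_neq0] := eqVneq r 0.
    move: ik kj; rewrite r_0 addr0 esh A0 Ai ltrDl pmulr_lgt0 // => s_gt0 kj _.
    have jn : i + n%:Z < j.
      by apply: le_lt_trans kj; rewrite lerD2l ler_pMl.
    have := y_sign jn; case: (eps i) => ys; rewrite ltr_pM2l //.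
      by rewrite gtrDl pmulr_rlt0 //; move: ys; clear; lia.
    by rewrite ltrDl pmulr_rgt0 //; move: ys; clear; lia.
  have [r_j|r_neqj] := eqVneq r rj.
    have kE : i + r + s * n%:Z = j + (s - t) * n%:Z.
      by rewrite r_j jE mulrBl; clear; lia.
    move: ik kj; rewrite kE esh Aj Ai gtrDl pmulr_llt0 // => ik st _.
    have jn : i + n%:Z < j.
      have : (s - t) * n%:Z <= -1 * n%:Z.
        by rewrite ler_pM2r //; move: st; clear; lia.
      by move: ik; clear; lia.
    have eij : eps i != eps j by case: ij_schur => // -[_]; rewrite ltNge (ltW jn).
    have := y_sign jn; move: eij; case: (eps i); case: (eps j) => // _ ys;
      rewrite ltr_pM2l //.
      by rewrite ltrDl nmulr_rgt0 //; move: ys; clear; lia.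
    by rewrite gtrDl nmulr_rlt0 //; move: ys; clear; lia.
  have st : s <= t.
    have : s * n%:Z < (t + 1) * n%:Z.
      by rewrite mulrDl mul1r; move: kj r0 rjn; rewrite jE; clear; lia.
    by rewrite ltr_pM2r // ltzD1.
  have lr : l r = r by rewrite /l (negbTE r_neqj).
  have s0R : 0 <= s%:~R :> R by rewrite ler0z.
  have stR : s%:~R <= t%:~R :> R by rewrite ler_int.
  have [fu_lo fu_hi] := floor_bounds (u r).
  have [f0_lo f0_hi] := floor_bounds (u 0).
  have sy_lo := ler_wpM2l s0R y_bounds.1.
  have sy_hi := ler_wpM2l s0R y_bounds.2.
  have z0 : z 0 = Num.floor (u 0) by rewrite /z eqxx.
  rewrite AE // lr Ai uE u0E zgen // esh z0.
  case: (eps (i + r)); rewrite ler_pM2l // => hu.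
    have : Num.floor (u r) + s * y < Num.floor (u 0) + t + 1.
      rewrite -(ltr_int R) !intrD intrM mulr1z.
      by move: sy_hi; rewrite mulrDr mulr1; lra.
    move: (Num.floor (u r)) (Num.floor (u 0)) (s * y) => fu f0 sy h.
    have : n%:Z * (fu - L + sy) <= n%:Z * (f0 - 1).
      by rewrite ler_pM2l // /L; move: h t0; clear; lia.
    by rewrite mulrBr mulr1; move: rn; clear; lia.
  have : Num.floor (u 0) - 1 - 2 * t < Num.floor (u r) + s * y.
    rewrite -(ltr_int R) !intrB !intrD !intrM mulr1z.
    by move: sy_lo; rewrite mulrBr; lra.
  move: (Num.floor (u r)) (Num.floor (u 0)) (s * y) => fu f0 sy h.
  have : n%:Z * (f0 + 1) <= n%:Z * (fu + L + sy).
    by rewrite ler_pM2l // /L; move: h t0; clear; lia.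
  by rewrite mulrDr mulr1; move: r0 n0; clear; lia.
- move=> k; have [s [r [-> r0 rn]]] := residue_above i k n_gt0 => k0 kn.
  have sB : `|s| <= 2 * n%:Z + `|i|.
    apply: le_trans (_ : `|s * n%:Z| <= _).
      by rewrite normrM ler_peMr //; move: n_gt0; clear; lia.
    by move: k0 kn r0 rn; move: (s * _) => sn; clear; lia.
  have sBR : `|s%:~R| <= 2 * n%:R + `|i|%:~R :> R.
    by rewrite -intr_norm; have := sB; rewrite -(ler_int R) intrD intrM.
  have tR : 0 <= t%:~R :> R by rewrite ler0z.
  have ty_lo := ler_wpM2l tR y_bounds.1.
  have ty_hi := ler_wpM2l tR y_bounds.2.
  have zu : `|(z r)%:~R - u r| <= t%:~R * 2 + 4.
    have [fu_lo fu_hi] := floor_bounds (u r).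
    have [f0_lo f0_hi] := floor_bounds (u 0).
    rewrite ler_norml /z /L; case: eqVneq => [->|_]; first by lra.
    case: eqVneq => [->|_].
      rewrite intrB intrM; move: ty_lo ty_hi; rewrite mulrBr mulrDr mulr1 ujE.
      by move: f0_lo f0_hi; rewrite ujE; lra.
    by case: (eps _); rewrite ?intrB !intrD intrM; lra.
  have sy : `|s%:~R * (y%:~R - c')| <= `|s%:~R| * 2.
    by rewrite normrM ler_wpM2l // ler_norml; lra.
  have lR : `|(l r)%:~R / n%:R| <= 1 :> R.
    have [l0 ln] := l_bounds _ r0 rn.
    rewrite ger0_norm; last by rewrite divr_ge0 // ler0z.
    by rewrite ler_pdivrMr ?ltr0n // mul1r -[n%:R]/(n%:Z%:~R) ler_int ltW.
  rewrite AE // uE.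
  have -> : eta / n%:R * (n%:Z * (z r + s * y) + l r)%:~R -
      eta * (u r + s%:~R * c') =
      eta * (((z r)%:~R - u r) + s%:~R * (y%:~R - c') + (l r)%:~R / n%:R).
    rewrite !intrD !intrM !intrD -[n%:Z%:~R]/(n%:R).
    have n_neq0 : n%:R != 0 :> R by rewrite pnatr_eq0 -lt0n.
    by field.
  rewrite normrM gtr0_norm // -[X in _ < X](divfK (_ : B != 0)) ?gt_eqF //.
  rewrite -/eta ltr_pM2l //.
  apply: le_lt_trans (ler_normD _ _) _.
  apply: le_lt_trans (lerD (ler_normD _ _) lR) _.
  by rewrite /B; lra.
Qed.
End Approximation.

(** * Closures of regions and of real supports *)

Section RegionClosure.
Variables (R : realType) (n : nat) (T : periodic_poset n).

Lemma nbhs_eval (pi : {ptws int -> R}) t (e : R) : 0 < e ->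
  nbhs pi [set f : {ptws int -> R} | `|pi t - f t| < e].
Proof.
move=> e0; have := @proj_continuous _ (fun _ : int => R) t pi.
by move=> /(_ (ball (pi t) e)); apply; exact: nbhsx_ballx.
Qed.

Lemma closure_region (pi : {ptws int -> R}) : closure (region T) pi ->
  periodic_function n pi /\ forall p q, T p q -> pi p <= pi q.
Proof.
move=> clo.
have approx (e : R) (s : seq int) : 0 < e -> exists f : {ptws int -> R},
    region T f /\ forall t, t \in s -> `|pi t - f t| < e.
  move=> e0.
  have : nbhs pi [set f : {ptws int -> R} | forall t, t \in s -> `|pi t - f t| < e].
    elim: s => [|x s IH]; first by apply: filterE => f t.
    apply: filterS (filterI (nbhs_eval pi x e0) IH) => f [fx fs] t.
    by rewrite inE => /orP[/eqP->//|/fs].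
  by move=> /clo[f [Tf ft]]; exists f.
split=> [i j|p q Tpq].
  apply/eqP; rewrite -subr_eq0; apply/negPn/negP => ne.
  set x := _ - _ in ne.
  have [|f [[fper _] near]] := @approx (`|x| / 4) [:: i + n%:Z; i; j + n%:Z; j].
    by rewrite divr_gt0 // normr_gt0.
  have := near (i + n%:Z); have := near i; have := near (j + n%:Z); have := near j.
  rewrite !inE !eqxx !orbT => /(_ isT) n1 /(_ isT) n2 /(_ isT) n3 /(_ isT) n4.
  have := fper i j => fij.
  have : `|x| < `|x|.
    rewrite [X in `|X| < _](_ : x = (pi (i + n%:Z) - f (i + n%:Z)) - (pi i - f i)
       - (pi (j + n%:Z) - f (j + n%:Z)) + (pi j - f j)); last first.
      by rewrite /x; lra.
    move: n1 n2 n3 n4; rewrite !ltr_norml.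
    by move=> /andP[? ?] /andP[? ?] /andP[? ?] /andP[? ?]; lra.
  by rewrite ltxx.
rewrite leNgt; apply/negP => qp.
have [|f [[_ finc] near]] := @approx ((pi p - pi q) / 2) [:: p; q].
  by rewrite divr_gt0 // subr_gt0.
have := near p; have := near q; rewrite !inE !eqxx !orbT => /(_ isT) n1 /(_ isT) n2.
have := finc p q Tpq; move: n1 n2; rewrite !ltr_norml => /andP[? ?] /andP[? ?].
lra.
Qed.

(** Move from pi0 a little towards pi1; in the topology of pointwise convergence
it is enough that each value converges. *)
Lemma region_closure_segment (pi0 pi1 : {ptws int -> R}) :
  periodic_function n pi0 -> (forall p q, T p q -> pi0 p <= pi0 q) ->
  region T pi1 -> closure (region T) pi0.
Proof.
move=> per0 inc0 [per1 inc1] B nB.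
pose F (s : R) : {ptws int -> R} := fun t => pi0 t + s * (pi1 t - pi0 t).
have cF : F @ 0^'+ --> pi0.
  apply/cvg_sup => t; apply/cvg_image.
    by rewrite eqEsubset; split=> // y _; exists (fun _ => y).
  move=> U nU; exists ((fun f : int -> R => f t) @^-1` U); last first.
    by apply: image_preimage; rewrite eqEsubset; split=> // y _; exists (fun _ => y).
  have cFt : F ^~ t @ 0^'+ --> pi0 t.
    rewrite -[X in _ --> X]addr0 -[X in _ + X](mul0r (pi1 t - pi0 t)).
    apply: cvgD; first exact: cvg_cst.
    apply: cvgM; last exact: cvg_cst.
    exact: cvg_at_right_filter.
  exact: cFt.
have : \forall s \near 0^'+, B (F s) by exact: cF.
move=> nearB.
have [s [Bs s0 s1]] : exists s, [/\ B (F s), 0 < s & s < 1].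
  near (0 : R)^'+ => s; exists s; split; near: s => //.
  - exact: nbhs_right_gt.
  - exact: nbhs_right_lt.
exists (F s); split=> //; split=> [i j|p q Tpq].
  by rewrite /F; have := per0 i j; have := per1 i j; nra.
rewrite /F; have := inc0 p q Tpq; have := inc1 p q Tpq; nra.
Unshelve. all: by end_near.
Qed.
End RegionClosure.

Lemma dvdz_translate n (i k : int) : (n%:Z %| k - i)%Z ->
  exists s, k = i + s * n%:Z.
Proof. by move=> /dvdzP[s E]; exists s; rewrite -E addrC subrK. Qed.

(** Doubling the heights leaves room to lift the translates of j just above
those of i, which makes the heights injective and puts nothing between i and
j. *)
Lemma tree_from_heights (R : realType) n eps (A : int -> int) (C : int) i j :
  periodic_sign n eps -> real_schur_pair n eps i j ->
  (forall k, A (k + n%:Z) = A k + C) -> A i = A j ->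
  (forall p q, A p = A q -> p = q \/
        exists s, (p = i + s * n%:Z /\ q = j + s * n%:Z) \/
                  (p = j + s * n%:Z /\ q = i + s * n%:Z)) ->
  (forall k, i < k -> k < j -> if eps k then A k < A i else A i < A k) ->
  exists T : periodic_tree n eps, is_edge T i j /\
    forall delta : R, 0 < delta ->
      closure (region T) (fun k => delta * (A k)%:~R : R).
Proof.
move=> per schur Aper Aij Ainj Asplit; have ij := schur.1.
pose lift (k : int) : int := if (n%:Z %| k - j)%Z then 1 else 0.
have lift_per k : lift (k + n%:Z) = lift k.
  rewrite /lift addrAC; congr (if _ then _ else _).
  by rewrite !(sameP dvdz_mod0P eqP) modzDr.
have lift_j s : lift (j + s * n%:Z) = 1.
  by rewrite /lift addrC addKr dvdz_mull.
have lift_i s : lift (i + s * n%:Z) = 0.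
  rewrite /lift; case: ifP => // /dvdz_translate[s' E].
  case: (schur_not_translate per schur (s := s - s')).
  by rewrite mulrBl addrA E addrK.
have lift01 k : lift k = 0 \/ lift k = 1 by rewrite /lift; case: ifP; tauto.
pose H k := 2 * A k + lift k.
have H_per k : H (k + n%:Z) = H k + 2 * C.
  by rewrite /H Aper lift_per; clear; lia.
have H_inj : injective H.
  move=> p q Hpq; have [] := Ainj p q.
    by move: Hpq (lift01 p) (lift01 q); rewrite /H; clear; lia.
  - by [].
  - move=> [s [[pE qE]|[pE qE]]]; move: Hpq; rewrite /H pE qE lift_i lift_j;
    by clear; lia.
have hij : H j = H i + 1.
  have := lift_i 0; have := lift_j 0; rewrite /H mul0r !addr0 Aij => -> ->.
  by rewrite addr0.
have li : lift i = 0 by have := lift_i 0; rewrite mul0r addr0.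
exists (height_tree per H_inj H_per); split.
  apply: height_tree_edge => //; split=> [|k]; first by rewrite hij ltrDl.
  rewrite /between => /orP[/andP[ik kj]|/andP[jk ki]]; last first.
    by have := lt_trans jk ki; move: ij; clear; lia.
  have := Asplit k ik kj; rewrite hij /H li; move: (lift01 k).
  by case: (eps k); clear; lia.
move=> delta delta0.
pose half : {ptws int -> R} := fun k => delta * ((A k)%:~R + (lift k)%:~R / 2).
have mono p q : height_lt eps H p q -> A p < A q \/ (A p = A q /\ lift p < lift q).
  move=> /height_ltW; rewrite /H; move: (lift01 p) (lift01 q); clear; lia.
have lift_lt p q : lift p < lift q -> lift p = 0 /\ lift q = 1.
  by move: (lift01 p) (lift01 q); clear; lia.
apply: (@region_closure_segment _ _ _ _ half).
- by move=> x y; rewrite !Aper !intrD; ring.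
- move=> p q /mono Apq; rewrite ler_pM2l // ler_int.
  by case: Apq => [/ltW//|[-> _]].
split=> [x y|p q /mono Apq].
  by rewrite /half !Aper !lift_per !intrD; ring.
rewrite /half ltr_pM2l //; case: Apq => [Apq|[-> /lift_lt[-> ->]]]; last first.
  by rewrite mul0r addr0 mul1r ltrDl invr_gt0.
have : (A p)%:~R + 1 <= (A q)%:~R :> R by rewrite -intrD1 ler_int; lia.
by case: (lift01 p) => ->; case: (lift01 q) => ->; lra.
Qed.
Section Boundary.
Variables (R : realType) (K : fieldType) (n : nat) (eps : int -> bool).

Lemma boundary_sign_split (T : periodic_tree n eps) i j (pi : int -> R) :
  is_edge T i j -> (forall p q, T p q -> pi p <= pi q) -> pi i = pi j ->
  sign_split eps i j pi.
Proof.
move=> [ij ed] inc pij; split=> // k ik kj.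
have bt : between k i j by rewrite /between ik kj.
have := edge_side ed bt; case: (eps k) => /= -[/inc|/inc] //;
by rewrite pij.
Qed.

Lemma sign_split_shift i j s (pi : int -> R) : periodic_sign n eps ->
  periodic_function n pi ->
  sign_split eps (i + s * n%:Z) (j + s * n%:Z) pi -> sign_split eps i j pi.
Proof.
move=> per pper [pij spl].
have shift k : pi (k + s * n%:Z) = pi k + s%:~R * (pi n%:Z - pi 0).
  exact: periodic_function_shift.
split=> [|k ik kj]; first by move: pij; rewrite !shift => /addIr.
have := spl (k + s * n%:Z); rewrite !ltrD2r => /(_ ik kj).
by rewrite periodic_sign_shift // !shift !lerD2r.
Qed.

Lemma euler_form_continuous (y : 'cV[R]_n) :
  continuous (fun v : 'cV[R]_n => euler_form eps v y).
Proof.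
have -> : (fun v : 'cV[R]_n => euler_form eps v y) =
    fun v : 'cV[R]_n => \sum_w v w 0 * (euler_matrix n eps R *m y) w 0.
  apply/funext => v; rewrite /euler_form -mulmxA mxE.
  by apply: eq_bigr => w _; rewrite mxE.
apply: continuous_big => [|w _ v]; first exact: add_continuous.
by apply: continuousM; [exact: coord_continuous | exact: cst_continuous].
Qed.

Lemma real_support_closed i j : closed (real_support R n eps K i j).
Proof.
have closed_form y (A : set R) : closed A ->
    closed [set v : 'cV[R]_n | A (euler_form eps v y)].
  by apply: closed_comp => v _; exact: euler_form_continuous.
move=> v clo; split.
  have : closed [set v : 'cV[R]_n | euler_form eps v (beta_real R n i j) = 0].
    exact: (closed_form _ [set x | x = 0] (@closed_eq R 0)).
  by apply; apply: closure_subset clo => u [].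
move=> a b ab sub.
have : closed [set v : 'cV[R]_n | euler_form eps v (beta_real R n a b) <= 0].
  exact: (closed_form _ [set x | x <= 0] (@closed_le R 0)).
by apply; apply: closure_subset clo => u [_]; apply.
Qed.


Hypotheses (n_ge2 : (2 <= n)%N) (per : periodic_sign n eps).
Hypothesis surj : surjective_sign eps.

Let n_gt0 : (0 < n)%N := ltnW n_ge2.

Lemma edge_boundary_support (T : periodic_tree n eps) i j i' j' s :
  is_edge T i' j' -> real_schur_pair n eps i j ->
  i' = i + s * n%:Z -> j' = j + s * n%:Z ->
  edge_boundary R eps T i' j' `<=` real_support R n eps K i j.
Proof.
move=> ed schur iE jE v [pi [/closure_region[pper inc] pij ->]].
apply: sign_split_support => //; apply: (@sign_split_shift _ _ s) => //.
by rewrite -iE -jE; exact: boundary_sign_split ed inc pij.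
Qed.

Lemma increments_close (M : 'M[R]_n) (e : R) : 0 < e ->
  exists2 d : R, 0 < d & forall pi pi' : int -> R,
    (forall k, 0 <= k -> k <= n%:Z -> `|pi' k - pi k| < d) ->
    ball (M *m increments n pi) e (M *m increments n pi').
Proof.
move=> e0; pose B := \sum_w \sum_u `|M w u| + 1.
have B0 : 0 < B.
  by rewrite ltr_wpDl // sumr_ge0 // => w _; exact: sumr_ge0.
exists (e / (2 * B)); first by rewrite divr_gt0 // mulr_gt0.
set d := e / (2 * B) => pi pi' near; split=> // w z.
rewrite ord1 /ball /= !mxE -sumrB.
have B_neq0 : B != 0 := lt0r_neq0 B0.
have dB : d * 2 * B = e by rewrite /d; field.
have d0 : 0 < d by rewrite divr_gt0 // mulr_gt0.
apply: le_lt_trans (_ : (\sum_u `|M w u|) * (d * 2) < _); last first.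
  have d20 : 0 < d * 2 by exact: mulr_gt0.
  rewrite -dB [X in _ < X]mulrC ltr_pM2r //.
  rewrite /B [X in _ < X + 1](bigD1 w) //= -addrA ltrDl.
  by rewrite ltr_wpDl // sumr_ge0 // => x _; exact: sumr_ge0.
apply: le_trans (ler_norm_sum _ _ _) _; rewrite mulr_suml; apply: ler_sum => u _.
rewrite !mxE -mulrBr normrM ler_wpM2l //.
have un := ltn_ord u.
have := near u; have := near u.+1.
move=> /(_ isT) h1 /(_ isT) h2.
have {}h1 := h1 ltac:(by rewrite lez_nat).
have {}h2 := h2 ltac:(by rewrite lez_nat ltnW).
have -> : pi u.+1 - pi u - (pi' u.+1 - pi' u) =
   - (pi' u.+1 - pi u.+1) + (pi' u - pi u) by ring.
apply: le_trans (ler_normD _ _) _; rewrite normrN.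
by move: h1 h2; lra.
Qed.

Lemma support_approximation i j (v : 'cV[R]_n) (e : R) :
  real_schur_pair n eps i j -> real_support R n eps K i j v -> 0 < e ->
  exists v' (T : periodic_tree n eps),
    [/\ ball v e v', is_edge T i j & edge_boundary R eps T i j v'].
Proof.
move=> schur vD e0.
have [pi pper piE] :=
  exists_periodic_function n_gt0 ((euler_matrix n eps R)^T *m v).
have vE : v = invmx (euler_matrix n eps R)^T *m increments n pi.
  by rewrite piE mulKmx // unitmx_tr euler_matrix_unit.
have split : sign_split eps i j pi.
  by apply: (support_sign_split (K := K) n_ge2 per surj schur pper); rewrite -vE.
have [d d0 dP] := increments_close (invmx (euler_matrix n eps R)^T) e0.
have [A [C [delta [[delta0 Aper] Aij Ainj Asplit Anear]]]] :=
  integer_approximation n_gt0 per schur pper split d0.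
have [T [ed clo]] := tree_from_heights R per schur Aper Aij Ainj Asplit.
exists (invmx (euler_matrix n eps R)^T *m
  increments n (fun k => delta * (A k)%:~R)), T.
split=> //; first by rewrite vE; exact: dP.
exists (fun k => delta * (A k)%:~R); split=> //; first exact: clo.
by rewrite Aij.
Qed.
End Boundary.

(** * Edge vectors *)

(** Pairing with the identity function recovers j - i; pairing with the
indicator function of the residue class of i, which misses j, recovers that
class. *)
Lemma beta_inj (R : realType) n eps i j i' j' : (0 < n)%N ->
  periodic_sign n eps -> real_schur_pair n eps i j -> i' < j' ->
  beta n i' j' = beta n i j ->
  exists s, i' = i + s * n%:Z /\ j' = j + s * n%:Z.
Proof.
move=> n_gt0 per schur ij' E; have ij := schur.1.
have pair (psi : int -> R) : periodic_function n psi ->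
    psi j' - psi i' = psi j - psi i.
  move=> pp; rewrite -!(pairing_beta n_gt0 pp) ?(ltW ij) ?(ltW ij') //.
  by rewrite /beta_real E.
have len : j' - i' = j - i.
  apply: (@intr_inj R); rewrite !intrB; apply: (pair (fun k => k%:~R)) => x y.
  by rewrite !intrD; lra.
pose chi (k : int) : R := ((n%:Z %| k - i)%Z)%:R.
have chi_per : periodic_function n chi.
  have one x : chi (x + n%:Z) = chi x.
    rewrite /chi addrAC; congr (nat_of_bool _)%:R.
    by rewrite !(sameP dvdz_mod0P eqP) modzDr.
  by move=> x y; rewrite !one !subrr.
have chij : chi j = 0.
  rewrite /chi; case: (boolP (_ %| _)%Z) => // /dvdz_translate[s].
  by move/(schur_not_translate per schur).
have chii : chi i = 1 by rewrite /chi subrr dvdz0.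
have := pair chi chi_per; rewrite chij chii {2}/chi.
case: (boolP (_ %| i' - i)%Z) => [/dvdz_translate[s i'E] _|_].
  by exists s; split=> //; move: len; rewrite i'E; clear; lia.
by rewrite /chi; case: (_ %| _)%Z => /=; lra.
Qed.

(** Pairing with the identity function gives j' - i' and j - i, which cannot be
opposite since both are positive. *)
Lemma opposite_beta (R : realType) n i j i' j' : (0 < n)%N ->
  i < j -> i' < j' -> beta n i' j' <> - beta n i j.
Proof.
move=> n_gt0 ij ij' E.
have pp : periodic_function n (fun k : int => k%:~R : R).
  by move=> x y; rewrite !intrD; lra.
have := pairing_beta n_gt0 pp (ltW ij').
have -> : beta_real R n i' j' = - beta_real R n i j.
  by rewrite /beta_real E map_mxN.
rewrite mulmxN mxE pairing_beta ?(ltW ij) // => /eqP.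
rewrite -!intrB -intrN eqr_int => /eqP.
by move: ij ij'; clear; lia.
Qed.

Theorem theorem0p0p3 (R : realType) (k : fieldType) (n : nat)
    (eps : int -> bool) (n_ge2 : (2 <= n)%N)
    (eps_periodic : periodic_sign n eps) (eps_surj : surjective_sign eps)
    (T : periodic_tree n eps) (i j : int) (edge_ij : is_edge T i j) :
  edge_boundary R eps T i j `<=` real_support R n eps k i j /\
  real_support R n eps k i j =
    closure [set v : 'cV[R]_n |
      exists (T' : periodic_tree n eps) (i' j' : int),
        [/\ is_edge T' i' j',
            edge_vector T' i' j' = edge_vector T i j \/
            edge_vector T' i' j' = - edge_vector T i j &
            edge_boundary R eps T' i' j' v]].
Proof.
have n_gt0 : (0 < n)%N := ltnW n_ge2.
have schur := edge_real_schur n_gt0 eps_periodic eps_surj edge_ij.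
have sub := @edge_boundary_support R k n eps n_ge2 eps_periodic eps_surj.
split; first by apply: (sub T _ _ _ _ 0); rewrite ?mul0r ?addr0.
apply/seteqP; split=> [v vD B /nbhs_ballP[e e0 eB]|v clo].
  have [v' [T' [vv' ed bd]]] :=
    support_approximation n_ge2 eps_periodic eps_surj schur vD e0.
  exists v'; split; last exact: eB.
  exists T', i, j; split=> //; rewrite /edge_vector.
  by case: (T' i j); case: (T i j); rewrite ?opprK; [left | right | right | left].
apply: real_support_closed; apply: closure_subset clo => u.
move=> [T' [i' [j' [ed ev bd]]]]; have ij' := ed.1.
have bE : beta n i' j' = beta n i j.
  have : beta n i' j' = beta n i j \/ beta n i' j' = - beta n i j.
    move: ev; rewrite /edge_vector; case: (T' i' j'); case: (T i j) => -[] E;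
    by [left | right | left; rewrite E opprK | right; rewrite -E opprK
       | left; exact: oppr_inj | right; exact: oppr_inj].
  by case=> // /(opposite_beta R n_gt0 edge_ij.1 ij').
have [s [iE jE]] := beta_inj R n_gt0 eps_periodic schur ij' bE.
exact: (sub T' _ _ _ _ s) ed schur iE jE _ bd.
Qed.
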